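(* Let $X$ be a compact geodesic metric space with basepoint $\bullet$, let $G$ be an Abelian group, and let $r>0$. \begin{enumerate} \item Let $c$ be the largest critical value of the $\pi_1$-persistence of $X$ via open Rips complexes that is smaller than $r$; if no critical value is smaller than $r$, let $c$ be any number in $(0,r)$. Let $S\subset X$ be a finite $\frac{r-c}{2}$-dense subset containing $\bullet$. Then the map $\mu^{\pi_1,S}_r\colon \pi_1(\mathrm{Rips}(S,r),\bullet)\to\pi_1(\mathrm{Rips}(X,r),\bullet)$ induced by the inclusion $S\hookrightarrow X$ is an isomorphism. \item Likewise, if $c$ is the largest critical value of the $H_1(\_;G)$-persistence of $X$ via open Rips complexes that is smaller than $r$ (or any number in $(0,r)$ if no critical value is smaller than $r$), and $S\subset X$ is a finite $\frac{r-c}{2}$-dense subset containing $\bullet$, then the inclusion-induced map $\mu^{G,S}_r\colon H_1(\mathrm{Rips}(S,r);G)\to H_1(\mathrm{Rips}(X,r);G)$ is an isomorphism. \end{enumerate}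
   Context: A metric space $(X,d)$ is geodesic if any $x,y\in X$ are joined by a path of length $d(x,y)$. A subset $S\subset X$ is $s$-dense if for every $x\in X$ there is $y\in S$ with $d(x,y)<s$; $S$ carries the restricted metric. For a metric space $Y$ and $r>0$, the (open) Rips complex $\mathrm{Rips}(Y,r)$ is the simplicial complex with vertex set $Y$ in which a finite nonempty $\sigma\subset Y$ is a simplex iff $\mathrm{Diam}(\sigma)<r$. The $\pi_1$-persistence (resp. $H_1(\_;G)$-persistence) of $X$ is the collection of groups $\pi_1(\mathrm{Rips}(X,r),\bullet)$ (resp. $H_1(\mathrm{Rips}(X,r);G)$), $r>0$, with bonding maps $i_{p,q}$ ($p<q$) induced by the inclusions $\mathrm{Rips}(X,p)\hookrightarrow\mathrm{Rips}(X,q)$. A number $p>0$ is a critical value of a persistence if either (left critical) $i_{p-\varepsilon,p}$ is not an isomorphism for all small enough $\varepsilon>0$, or (right critical) $i_{p,p+\varepsilon}$ is not an isomorphism for all $\varepsilon>0$. For compact geodesic $X$ and each $t>0$ only finitely many critical values are greater than $t$, so the largest critical value smaller than $r$ exists whenever some critical value is smaller than $r$. *)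

(* Defs.v *)
From HB Require Import structures.
From mathcomp Require Import all_boot all_order all_algebra.
From mathcomp Require Import generic_quotient ring_quotient lra.
From mathcomp Require Import all_classical all_reals all_analysis.

Set Implicit Arguments.
Unset Strict Implicit.
Unset Printing Implicit Defensive.

Import Order.TTheory GRing.Theory Num.Theory.
Import numFieldNormedType.Exports.

Local Open Scope classical_set_scope.
Local Open Scope ring_scope.
Local Open Scope quotient_scope.

Section within_continuity.

Lemma continuous_pair (U V W : topologicalType) (f : U -> V) (g : U -> W) :
  continuous f -> continuous g -> continuous (fun u => (f u, g u)).
Proof. by move=> cf cg u; apply: (cvg_pair (cf u) (cg u)). Qed.

Lemma within_comp (U V W : topologicalType) (A : set U) (B : set V)
    (f : U -> V) (g : V -> W) :
  {within A, continuous f} -> {within B, continuous g} ->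
  (forall a, A a -> B (f a)) -> {within A, continuous (g \o f)}.
Proof.
move=> /subspace_continuousP cf /subspace_continuousP cg AB.
apply/subspace_continuousP => a Aa N /= /(cg _ (AB _ Aa)) gN.
have := cf _ Aa _ gN; rewrite /= !nbhs_simpl /within /=.
by apply: filterS => y + Ay; apply=> //; exact: AB.
Qed.

Lemma within_if (R : realType) (U V : topologicalType) (A : set U)
    (phi : U -> R) (c : R) (f g : U -> V) :
  closed A -> continuous phi ->
  {within A `&` [set u | phi u <= c], continuous f} ->
  {within A `&` [set u | c <= phi u], continuous g} ->
  (forall u, A u -> phi u = c -> f u = g u) ->
  {within A, continuous (fun u => if phi u <= c then f u else g u)}.
Proof.
move=> clA cphi cf cg fg.
have -> : A = (A `&` [set u | phi u <= c]) `|` (A `&` [set u | c <= phi u]).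
  apply/seteqP; split=> [u Au|u [[]|[]]//].
  by have [uc|/ltW cu] := leP (phi u) c; [left|right].
apply: withinU_continuous.
- apply: closedI => //; apply: (@closed_comp _ _ phi [set x | x <= c]).
    by move=> u _; apply: cphi.
  exact: closed_le.
- apply: closedI => //; apply: (@closed_comp _ _ phi [set x | c <= x]).
    by move=> u _; apply: cphi.
  exact: closed_ge.
- by apply: subspace_eq_continuous cf => u /[!inE] -[_ /= uc]; rewrite /from_subspace uc.
- apply: subspace_eq_continuous cg => u /[!inE] -[Au /= cu]; rewrite /from_subspace.
  by case: ifPn => // uc; rewrite fg//; apply/eqP; rewrite eq_le uc.
Qed.

End within_continuity.

Local Ltac split_ifs := repeat match goal with
  | |- context [if ?a < ?b then _ else _] =>
    lazymatch constr:((a, b)) with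
    | context [if _ then _ else _] => fail
    | _ => case: (ltP a b) => ?
    end
  | |- context [if ?a <= ?b then _ else _] =>
    lazymatch constr:((a, b)) with
    | context [if _ then _ else _] => fail
    | _ => case: (leP a b) => ?
    end
  end.

Section fundamental_group.
Context (R : realType).
Local Notation I := (`[0 : R, 1]%classic).
Local Notation square := (`[0 : R, 1]%classic `*` `[0 : R, 1]%classic).

Section loops.
Context {T : topologicalType} (x : T).

Definition is_loop (f : R -> T) :=
  [/\ {within I, continuous f}, f 0 = x & f 1 = x].

Record loop := Loop { loop_fun :> R -> T; loopP : is_loop loop_fun }.

HB.instance Definition _ := gen_eqMixin loop.
HB.instance Definition _ := gen_choiceMixin loop.

(* Loops are only meaningful on [0, 1], so that two loops which agree there
   are homotopic. *)
Definition homotopic (f g : R -> T) := exists H : R * R -> T,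
  [/\ {within square, continuous H},
      forall s, I s -> H (s, 0) = f s /\ H (s, 1) = g s &
      forall t, I t -> H (0, t) = x /\ H (1, t) = x].

Definition concat (f g : R -> T) (s : R) : T :=
  if s <= 2^-1 then f (2 * s) else g (2 * s - 1).

Definition reverse (f : R -> T) (s : R) : T := f (1 - s).

Lemma closed_square : closed square.
Proof.
have -> : square = (fst @^-1` I) `&` (snd @^-1` I) by [].
apply: closedI; apply: closed_comp; try exact: itv_closed.
- by move=> p _; exact: cvg_fst.
- by move=> p _; exact: cvg_snd.
Qed.

Lemma reparametrization (f : R -> T) (phi psi : R -> R) :
  {within I, continuous f} -> continuous phi -> continuous psi ->
  (forall s, I s -> I (phi s)) -> (forall s, I s -> I (psi s)) ->
  phi 0 = psi 0 -> phi 1 = psi 1 -> f (phi 0) = x -> f (phi 1) = x ->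
  homotopic (f \o phi) (f \o psi).
Proof.
move=> cf cphi cpsi Iphi Ipsi e0 e1 fx0 fx1.
exists (fun p => f (phi p.1 + p.2 * (psi p.1 - phi p.1))); split.
- apply: (within_comp (f := fun p : R * R => phi p.1 + p.2 * (psi p.1 - phi p.1))
    (g := f) (B := I)) => //.
    apply: continuous_subspaceT => p.
    have c1 : phi q.1 @[q --> p] --> phi p.1.
      by apply: (@continuous_comp _ _ _ fst phi); [exact: cvg_fst|exact: cphi].
    have c2 : psi q.1 @[q --> p] --> psi p.1.
      by apply: (@continuous_comp _ _ _ fst psi); [exact: cvg_fst|exact: cpsi].
    by apply: cvgD => //; apply: cvgM; [exact: cvg_snd|exact: cvgB].
  move=> [s t] /= [Is]; have := Iphi _ Is; have := Ipsi _ Is.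
  rewrite /= !in_itv /= => /andP[a0 a1] /andP[b0 b1] /andP[t0 t1].
  by apply/andP; split; nra.
- by move=> s _ /=; rewrite mul0r addr0 mul1r subrKC.
- by move=> t _ /=; rewrite -e0 -e1 !subrr !mulr0 !addr0.
Qed.

Lemma homotopic_refl (f : R -> T) : is_loop f -> homotopic f f.
Proof.
move=> [cf f0 f1]; apply: (@reparametrization f id id) => //.
- by move=> s; exact: cvg_id.
- by move=> s; exact: cvg_id.
Qed.

Lemma homotopic_sym (f g : R -> T) : homotopic f g -> homotopic g f.
Proof.
move=> [H [cH Hs Ht]]; exists (fun p => H (p.1, 1 - p.2)); split.
- apply: (within_comp (f := fun p : R * R => (p.1, 1 - p.2)) (g := H)
    (B := square)) => //.
    apply/continuous_subspaceT/continuous_pair => p; first exact: cvg_fst.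
    by apply: cvgB; [exact: cvg_cst|exact: cvg_snd].
  move=> [s t] /= [Is]; rewrite !in_itv /= => /andP[t0 t1]; split=> //.
  by apply/andP; split; lra.
- by move=> s Is; rewrite /= subr0 subrr; have [] := Hs _ Is.
- by move=> t /=; rewrite in_itv /= => /andP[t0 t1]; apply: Ht;
    rewrite /= in_itv /=; apply/andP; split; lra.
Qed.

Lemma homotopic_trans (f g h : R -> T) :
  homotopic f g -> homotopic g h -> homotopic f h.
Proof.
move=> [H [cH Hs Ht]] [K [cK Ks Kt]].
exists (fun p => if p.2 <= 2^-1 then H (p.1, 2 * p.2) else K (p.1, 2 * p.2 - 1)).
split.
- apply: (@within_if R _ _ square snd 2^-1 (fun p => H (p.1, 2 * p.2))
    (fun p => K (p.1, 2 * p.2 - 1))).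
  + exact: closed_square.
  + by move=> p; exact: cvg_snd.
  + apply: (within_comp (f := fun p : R * R => (p.1, 2 * p.2)) (g := H)
      (B := square)) => //.
      apply/continuous_subspaceT/continuous_pair => p; first exact: cvg_fst.
      by apply: cvgM; [exact: cvg_cst|exact: cvg_snd].
    move=> [s t] /= [[Is]]; rewrite !in_itv /= => /andP[t0 t1] t2; split=> //.
    by apply/andP; split; lra.
  + apply: (within_comp (f := fun p : R * R => (p.1, 2 * p.2 - 1)) (g := K)
      (B := square)) => //.
      apply/continuous_subspaceT/continuous_pair => p; first exact: cvg_fst.
      apply: cvgB; last exact: cvg_cst.
      by apply: cvgM; [exact: cvg_cst|exact: cvg_snd].
    move=> [s t] /= [[Is]]; rewrite !in_itv /= => /andP[t0 t1] t2; split=> //.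
    by apply/andP; split; lra.
  + move=> [s t] /= [Is _] ->; rewrite divff// subrr.
    by rewrite (Hs _ Is).2 (Ks _ Is).1.
- move=> s Is /=; rewrite mulr0 invr_ge0 ler0n; split; first exact: (Hs _ Is).1.
  rewrite ifF; last by apply/negbTE; rewrite -ltNge; lra.
  by rewrite (_ : 2 * 1 - 1 = 1 :> R); [exact: (Ks _ Is).2|lra].
- move=> t /=; rewrite in_itv /= => /andP[t0 t1].
  by have [tc|tc] := leP t 2^-1; [apply: Ht|apply: Kt];
    rewrite /= in_itv /=; apply/andP; split; lra.
Qed.

Lemma concat_loop (f g : R -> T) : is_loop f -> is_loop g -> is_loop (concat f g).
Proof.
move=> [cf f0 f1] [cg g0 g1]; split.
- apply: (@within_if R _ _ I id 2^-1 (fun s => f (2 * s))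
    (fun s => g (2 * s - 1))).
  + exact: itv_closed.
  + by move=> s; exact: cvg_id.
  + apply: (within_comp (f := fun s : R => 2 * s) (g := f) (B := I)) => //.
      apply: continuous_subspaceT => s.
      by apply: cvgM; [exact: cvg_cst|exact: cvg_id].
    move=> s /= []; rewrite !in_itv /= => /andP[s0 s1] s2.
    by apply/andP; split; lra.
  + apply: (within_comp (f := fun s : R => 2 * s - 1) (g := g) (B := I)) => //.
      apply: continuous_subspaceT => s; apply: cvgB; last exact: cvg_cst.
      by apply: cvgM; [exact: cvg_cst|exact: cvg_id].
    move=> s /= []; rewrite !in_itv /= => /andP[s0 s1] s2.
    by apply/andP; split; lra.
  + by move=> s _ ->; rewrite divff// subrr f1 g0.
- by rewrite /concat mulr0 invr_ge0 ler0n.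
- rewrite /concat ifF; last by apply/negbTE; rewrite -ltNge; lra.
  by rewrite (_ : 2 * 1 - 1 = 1 :> R); [|lra].
Qed.

Lemma reverse_loop (f : R -> T) : is_loop f -> is_loop (reverse f).
Proof.
move=> [cf f0 f1]; split; rewrite /reverse ?subr0 ?subrr//.
apply: (within_comp (f := fun s : R => 1 - s) (g := f) (B := I)) => //.
  apply: continuous_subspaceT => s.
  by apply: cvgB; [exact: cvg_cst|exact: cvg_id].
move=> s /=; rewrite !in_itv /= => /andP[s0 s1].
by apply/andP; split; lra.
Qed.

Lemma cst_loop : is_loop (fun=> x).
Proof. by split=> //; apply: continuous_subspaceT => s; exact: cvg_cst. Qed.

Lemma homotopic_concat (f f' g g' : R -> T) :
  homotopic f f' -> homotopic g g' -> homotopic (concat f g) (concat f' g').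
Proof.
move=> [H [cH Hs Ht]] [K [cK Ks Kt]].
exists (fun p => if p.1 <= 2^-1 then H (2 * p.1, p.2) else K (2 * p.1 - 1, p.2)).
have I0 : I 0 by rewrite /= in_itv /= lexx ler01.
have I1 : I 1 by rewrite /= in_itv /= lexx ler01.
split.
- apply: (@within_if R _ _ square fst 2^-1 (fun p => H (2 * p.1, p.2))
    (fun p => K (2 * p.1 - 1, p.2))).
  + exact: closed_square.
  + by move=> p; exact: cvg_fst.
  + apply: (within_comp (f := fun p : R * R => (2 * p.1, p.2)) (g := H)
      (B := square)) => //.
      apply/continuous_subspaceT/continuous_pair => p; last exact: cvg_snd.
      by apply: cvgM; [exact: cvg_cst|exact: cvg_fst].
    move=> [s t] /= [[+ It]]; rewrite !in_itv /= => /andP[t0 t1] t2; split=> //.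
    by apply/andP; split; lra.
  + apply: (within_comp (f := fun p : R * R => (2 * p.1 - 1, p.2)) (g := K)
      (B := square)) => //.
      apply/continuous_subspaceT/continuous_pair => p; last exact: cvg_snd.
      apply: cvgB; last exact: cvg_cst.
      by apply: cvgM; [exact: cvg_cst|exact: cvg_fst].
    move=> [s t] /= [[+ It]]; rewrite !in_itv /= => /andP[t0 t1] t2; split=> //.
    by apply/andP; split; lra.
  + move=> [s t] /= [_ It] ->; rewrite divff// subrr.
    by rewrite (Ht _ It).2 (Kt _ It).1.
- move=> s; rewrite /concat /= in_itv /= => /andP[t0 t1].
  by have [tc|tc] := leP s 2^-1; [apply: Hs|apply: Ks];
    rewrite /= in_itv /=; apply/andP; split; lra.
- move=> t It /=; rewrite mulr0 invr_ge0 ler0n; split; first exact: (Ht _ It).1.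
  rewrite ifF; last by apply/negbTE; rewrite -ltNge; lra.
  by rewrite (_ : 2 * 1 - 1 = 1 :> R); [exact: (Kt _ It).2|lra].
Qed.

Lemma homotopic_reverse (f g : R -> T) :
  homotopic f g -> homotopic (reverse f) (reverse g).
Proof.
move=> [H [cH Hs Ht]]; exists (fun p => H (1 - p.1, p.2)); split.
- apply: (within_comp (f := fun p : R * R => (1 - p.1, p.2)) (g := H)
    (B := square)) => //.
    apply/continuous_subspaceT/continuous_pair => p; last exact: cvg_snd.
    by apply: cvgB; [exact: cvg_cst|exact: cvg_fst].
  move=> [s t] /= [+ It]; rewrite !in_itv /= => /andP[t0 t1]; split=> //.
  by apply/andP; split; lra.
- by move=> s /=; rewrite in_itv /= => /andP[t0 t1]; apply: Hs;
    rewrite /= in_itv /=; apply/andP; split; lra.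
- by move=> t It; rewrite /= subr0 subrr; have [] := Ht _ It.
Qed.

Lemma homotopic_concatA (f g h : R -> T) :
  is_loop f -> is_loop g -> is_loop h ->
  homotopic (concat (concat f g) h) (concat f (concat g h)).
Proof.
move=> lf lg lh.
pose phi (s : R) := Num.min (2 * s) (Num.min (s + 4^-1) (2^-1 * s + 2^-1)).
have -> : concat (concat f g) h = concat f (concat g h) \o phi.
  apply/funext => s; rewrite /= /concat /phi !minElt.
  by split_ifs;
    solve [exfalso; lra | congr (_ _); lra].
have [cF F0 F1] := concat_loop lf (concat_loop lg lh).
have phi0 : phi 0 = 0 by rewrite /phi !minElt; split_ifs; lra.
have phi1 : phi 1 = 1 by rewrite /phi !minElt; split_ifs; lra.
apply: (@reparametrization _ phi id) => //; rewrite ?phi0 ?phi1//.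
- move=> s; apply: continuous_min; last apply: continuous_min.
  + by apply: cvgM; [exact: cvg_cst|exact: cvg_id].
  + by apply: cvgD; [exact: cvg_id|exact: cvg_cst].
  + apply: cvgD; last exact: cvg_cst.
    by apply: cvgM; [exact: cvg_cst|exact: cvg_id].
- by move=> s; exact: cvg_id.
- move=> s /=; rewrite !in_itv /= /phi !minElt => /andP[s0 s1].
  by apply/andP; split; split_ifs; lra.
Qed.

Let loop0 (f : R -> T) : is_loop f -> f 0 = x. Proof. by case. Qed.
Let loop1 (f : R -> T) : is_loop f -> f 1 = x. Proof. by case. Qed.

Lemma homotopic_cst_concat (f : R -> T) :
  is_loop f -> homotopic (concat (fun=> x) f) f.
Proof.
move=> lf; pose phi (s : R) := Num.max 0 (2 * s - 1).
have -> : concat (fun=> x) f = f \o phi.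
  apply/funext => s; rewrite /concat /phi /= maxElt.
  split_ifs;
    solve [exfalso; lra | congr (_ _); lra | rewrite -(loop0 lf); congr (_ _); lra].
have [cf f0 f1] := lf.
have phi0 : phi 0 = 0 by rewrite /phi !maxElt; split_ifs; lra.
have phi1 : phi 1 = 1 by rewrite /phi !maxElt; split_ifs; lra.
apply: (@reparametrization _ phi id) => //; rewrite ?phi0 ?phi1//.
- move=> s; apply: (@continuous_max R R (fun=> 0) (fun s => 2 * s - 1)); first exact: cvg_cst.
  apply: cvgB; last exact: cvg_cst.
  by apply: cvgM; [exact: cvg_cst|exact: cvg_id].
- by move=> s; exact: cvg_id.
- move=> s /=; rewrite !in_itv /= /phi !maxElt => /andP[s0 s1].
  by apply/andP; split; split_ifs; lra.
Qed.

Lemma homotopic_concat_cst (f : R -> T) :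
  is_loop f -> homotopic (concat f (fun=> x)) f.
Proof.
move=> lf; pose phi (s : R) := Num.min 1 (2 * s).
have -> : concat f (fun=> x) = f \o phi.
  apply/funext => s; rewrite /concat /phi /= minElt.
  split_ifs;
    solve [exfalso; lra | congr (_ _); lra | rewrite -(loop1 lf); congr (_ _); lra].
have [cf f0 f1] := lf.
have phi0 : phi 0 = 0 by rewrite /phi !minElt; split_ifs; lra.
have phi1 : phi 1 = 1 by rewrite /phi !minElt; split_ifs; lra.
apply: (@reparametrization _ phi id) => //; rewrite ?phi0 ?phi1//.
- move=> s; apply: (@continuous_min R R (fun=> 1) (fun s => 2 * s)); first exact: cvg_cst.
  by apply: cvgM; [exact: cvg_cst|exact: cvg_id].
- by move=> s; exact: cvg_id.
- move=> s /=; rewrite !in_itv /= /phi !minElt => /andP[s0 s1].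
  by apply/andP; split; split_ifs; lra.
Qed.

Lemma homotopic_concat_reverse (f : R -> T) :
  is_loop f -> homotopic (concat f (reverse f)) (fun=> x).
Proof.
move=> lf; pose phi (s : R) := Num.min (2 * s) (2 - 2 * s).
have -> : concat f (reverse f) = f \o phi.
  apply/funext => s; rewrite /concat /reverse /phi /= minElt.
  by split_ifs;
    solve [exfalso; lra | congr (_ _); lra].
have [cf f0 f1] := lf.
have -> : (fun=> x) = f \o (fun _ : R => (0 : R)) by apply/funext => s /=.
have phi0 : phi 0 = 0 by rewrite /phi !minElt; split_ifs; lra.
have phi1 : phi 1 = 0 by rewrite /phi !minElt; split_ifs; lra.
apply: (@reparametrization _ phi (fun=> 0)) => //; rewrite ?phi0 ?phi1//.
- move=> s; apply: continuous_min.
    by apply: cvgM; [exact: cvg_cst|exact: cvg_id].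
  apply: cvgB; first exact: cvg_cst.
  by apply: cvgM; [exact: cvg_cst|exact: cvg_id].
- by move=> s; exact: cvg_cst.
- move=> s /=; rewrite !in_itv /= /phi !minElt => /andP[s0 s1].
  by apply/andP; split; split_ifs; lra.
- by move=> s _ /=; rewrite in_itv /= lexx ler01.
Qed.

Lemma reverseK (f : R -> T) : reverse (reverse f) = f.
Proof. by apply/funext => s; rewrite /reverse subKr. Qed.

Definition homotopicb (f g : loop) : bool := `[< homotopic f g >].

Lemma homotopicb_equiv : equiv_class_of homotopicb.
Proof.
split=> [f|f g|g f h].
- by apply/asboolP/homotopic_refl/loopP.
- by apply/asboolP/asboolP; exact: homotopic_sym.
- by move=> /asboolP fg /asboolP gh; apply/asboolP/(homotopic_trans fg).
Qed.

Canonical homotopicb_equiv_rel := EquivRelPack homotopicb_equiv.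

Definition pi1 := {eq_quot homotopicb}%qT.

HB.instance Definition _ : EqQuotient loop homotopicb pi1 := EqQuotient.on pi1.
HB.instance Definition _ := Choice.on pi1.

Definition loop_class (f : loop) : pi1 := \pi f.

Definition pi1_one : pi1 := loop_class (Loop cst_loop).
Definition pi1_mul (a b : pi1) : pi1 :=
  loop_class (Loop (concat_loop (loopP (repr a)) (loopP (repr b)))).
Definition pi1_inv (a : pi1) : pi1 :=
  loop_class (Loop (reverse_loop (loopP (repr a)))).

Lemma loop_class_eq (f g : loop) :
  loop_class f = loop_class g <-> homotopic f g.
Proof.
by split=> [/eqmodP/asboolP|fg]//; apply/eqmodP/asboolP.
Qed.

Lemma repr_loop_class (f : loop) : homotopic (repr (loop_class f)) f.
Proof. by apply/loop_class_eq; rewrite /loop_class reprK. Qed.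

Let pi1_mulA : associative pi1_mul.
Proof.
move=> a b c; apply/loop_class_eq => /=.
apply: (homotopic_trans (homotopic_concat (homotopic_refl (loopP _))
  (repr_loop_class _))).
apply: homotopic_sym; apply: (homotopic_trans (homotopic_concat
  (repr_loop_class _) (homotopic_refl (loopP _)))).
by apply: homotopic_concatA; exact: loopP.
Qed.

Let pi1_mul1 : left_id pi1_one pi1_mul.
Proof.
move=> a; rewrite -[RHS]reprK; apply/loop_class_eq => /=.
apply: (homotopic_trans (homotopic_concat (repr_loop_class _)
  (homotopic_refl (loopP _)))).
by apply: homotopic_cst_concat; exact: loopP.
Qed.

Let pi1_1mul : right_id pi1_one pi1_mul.
Proof.
move=> a; rewrite -[RHS]reprK; apply/loop_class_eq => /=.
apply: (homotopic_trans (homotopic_concat (homotopic_refl (loopP _))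
  (repr_loop_class _))).
by apply: homotopic_concat_cst; exact: loopP.
Qed.

Let pi1_mulV : right_inverse pi1_one pi1_inv pi1_mul.
Proof.
move=> a; apply/loop_class_eq => /=.
apply: (homotopic_trans (homotopic_concat (homotopic_refl (loopP _))
  (repr_loop_class _))).
by apply: homotopic_concat_reverse; exact: loopP.
Qed.

Let pi1_Vmul : left_inverse pi1_one pi1_inv pi1_mul.
Proof.
move=> a; apply/loop_class_eq => /=.
apply: (homotopic_trans (homotopic_concat (repr_loop_class _)
  (homotopic_refl (loopP _)))) => /=.
rewrite -{2}[loop_fun (repr a)]reverseK.
by apply: homotopic_concat_reverse; apply: reverse_loop; exact: loopP.
Qed.

HB.instance Definition _ := isGroup.Build pi1
  pi1_mulA pi1_mul1 pi1_1mul pi1_Vmul pi1_mulV.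

End loops.

Section induced_map.
Context {T U : topologicalType} (F : T -> U) (cF : continuous F).
Context (x : T) (y : U) (Fxy : F x = y).

Lemma comp_loop (f : R -> T) : is_loop x f -> is_loop y (F \o f).
Proof.
move=> [cf f0 f1]; split; rewrite /= ?f0 ?f1//.
by apply: within_continuous_comp cf => t _; exact: cF.
Qed.

Lemma homotopic_comp (f g : R -> T) :
  homotopic x f g -> homotopic y (F \o f) (F \o g).
Proof.
move=> [H [cH Hs Ht]]; exists (F \o H); split.
- by apply: within_continuous_comp cH => t _; exact: cF.
- by move=> s /Hs[/= -> ->].
- by move=> t /Ht[/= -> ->].
Qed.

Definition pi1_map (a : pi1 x) : pi1 y :=
  loop_class (Loop (comp_loop (loopP (repr a)))).

Let pi1_mapM : {morph pi1_map : a b / (a * b)%g}.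
Proof.
move=> a b; apply/loop_class_eq => /=.
apply: (homotopic_trans (homotopic_comp (repr_loop_class _))) => /=.
apply: homotopic_sym.
apply: (homotopic_trans (homotopic_concat (repr_loop_class _)
  (repr_loop_class _))) => /=.
have -> : concat (F \o repr a) (F \o repr b) = F \o concat (repr a) (repr b).
  by apply/funext => s; rewrite /concat /=; case: ifP.
by apply: homotopic_comp; apply: homotopic_refl; apply: concat_loop; exact: loopP.
Qed.

HB.instance Definition _ := isMultiplicative.Build (pi1 x) (pi1 y) pi1_map pi1_mapM.

End induced_map.

End fundamental_group.

Arguments pi1 R {T} x.

Record simplicial_complex (V : Type) := SimplicialComplex {
  simplex :> set V -> Prop;
  simplex_finite : forall s, simplex s -> finite_set s;
  simplex_neq0 : forall s, simplex s -> s !=set0;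
  simplex_face : forall s t, simplex s -> t `<=` s -> t !=set0 -> simplex t
}.

Definition subcomplex (V : Type) (K L : simplicial_complex V) :=
  forall s, K s -> L s.

Section realization.
Context (R : realType) {V : choiceType}.
Implicit Types K L : simplicial_complex V.

Definition barycentric K (t : V -> R) :=
  [/\ forall v, 0 <= t v, K [set v | t v != 0] & \sum_(v \in [set: V]) t v = 1].

Record realization K := Realization {
  coordinate :> V -> R;
  coordinateP : barycentric K coordinate
}.

HB.instance Definition _ K := gen_eqMixin (realization K).
HB.instance Definition _ K := gen_choiceMixin (realization K).

Definition closed_simplex K (s : set V) : set (realization K) :=
  [set t | [set v | t v != 0] `<=` s].

(* The weak (coherent) topology: a set is open iff its trace on every closed
   simplex is relatively open for the Euclidean topology of that simplex, given
   here by the sup distance between barycentric coordinates. *)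
Definition open_realization K (U : set (realization K)) :=
  forall s, K s -> forall t, closed_simplex s t -> U t ->
  exists2 e : R, 0 < e & forall u : realization K, closed_simplex s u ->
    (forall v, `|t v - u v| < e) -> U u.

Section topology.
Context (K : simplicial_complex V).

Let open_realizationT : @open_realization K setT.
Proof. by move=> s _ t _ _; exists 1. Qed.

Let open_realizationI : setI_closed (@open_realization K).
Proof.
move=> A B oA oB s Ks t st [At Bt].
have [e e0 eA] := oA _ Ks _ st At; have [d d0 dB] := oB _ Ks _ st Bt.
exists (Num.min e d) => [|u su tu]; first by rewrite lt_min e0.
by split; [apply: eA|apply: dB] => // v; have := tu v; rewrite lt_min => /andP[].
Qed.

Let open_realization_bigU (I : Type) (f : I -> set (realization K)) :
  (forall i, open_realization (f i)) -> open_realization (\bigcup_i f i).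
Proof.
move=> of_ s Ks t st [i _ fit]; have [e e0 ef] := of_ i _ Ks _ st fit.
by exists e => // u su tu; exists i => //; exact: ef.
Qed.

HB.instance Definition _ := isOpenTopological.Build (realization K)
  open_realizationT open_realizationI open_realization_bigU.

Lemma open_realizationE : open = @open_realization K.
Proof. by []. Qed.

End topology.

Section vertex.
Context K (v : V) (Kv : K [set v]).

Let support_vertex : [set w | (w == v)%:R != 0 :> R] = [set v].
Proof. by apply/seteqP; split=> w /=; rewrite pnatr_eq0 eqb0 negbK => /eqP. Qed.

Let vertex_barycentric : barycentric K (fun w => (w == v)%:R).
Proof.
split=> [w||]; rewrite ?ler0n ?support_vertex//.
rewrite -(fsbig_widen [set v] setT) ?fsbig_set1 ?eqxx//.
by move=> w [_ /= /eqP/negbTE ->].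
Qed.

Definition vertex : realization K := Realization vertex_barycentric.

End vertex.

Section inclusion.
Context K L (KL : subcomplex K L).

Let inclusion_barycentric (t : realization K) : barycentric L t.
Proof. by case: t => t [? ? ?]; split=> //; exact: KL. Qed.

Definition realization_incl (t : realization K) : realization L :=
  Realization (inclusion_barycentric t).

Lemma realization_eq (t u : realization K) : t =1 u -> t = u.
Proof.
case: t u => [t Kt] [u Ku] /= /funext tu; rewrite tu in Kt *.
by rewrite (Prop_irrelevance Kt Ku).
Qed.

Lemma realization_incl_continuous : continuous realization_incl.
Proof.
apply/continuousP => U; rewrite !open_realizationE => oU s Ks t st Ut.
have [e e0 eU] := oU _ (KL Ks) (realization_incl t) st Ut.
by exists e => // u su tu; exact: (eU (realization_incl u)).
Qed.

Lemma realization_incl_vertex v (Kv : K [set v]) (Lv : L [set v]) :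
  realization_incl (vertex Kv) = vertex Lv.
Proof. by rewrite /realization_incl /vertex; congr Realization; exact: Prop_irrelevance. Qed.

End inclusion.

End realization.

Section homology.
Context {V : choiceType} (G : zmodType).
Implicit Types K L : simplicial_complex V.

(* Oriented simplicial chains with coefficients in G. The chain g [x, y] is the
   function with value g at (x, y), - g at (y, x) and 0 elsewhere; in general a
   chain is a finitely supported alternating function on tuples of vertices that
   vanishes on degenerate tuples, and its boundary is obtained by summing over
   the first vertex. *)
Definition chain1 K (c : V * V -> G) :=
  [/\ finite_set [set p | c p != 0],
      forall x y, c (x, y) != 0 -> K [set x; y],
      forall x y, c (y, x) = - c (x, y) &
      forall x, c (x, x) = 0].

Definition chain2 K (d : V * V * V -> G) :=
  [/\ finite_set [set p | d p != 0],
      forall x y z, d (x, y, z) != 0 -> K [set x; y; z],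
      forall x y z, d (y, x, z) = - d (x, y, z) /\ d (x, z, y) = - d (x, y, z) &
      forall x y, d (x, x, y) = 0].

Definition boundary1 (c : V * V -> G) (x : V) : G :=
  \sum_(v \in [set: V]) c (v, x).

Definition boundary2 (d : V * V * V -> G) (p : V * V) : G :=
  \sum_(v \in [set: V]) d (v, p.1, p.2).

Let finite_suppB (T : Type) (f g : T -> G) :
  finite_set [set t | f t != 0] -> finite_set [set t | g t != 0] ->
  finite_set [set t | (f - g) t != 0].
Proof.
move=> ff fg.
apply: (@sub_finite_set _ _ ([set t | f t != 0] `|` [set t | g t != 0])).
  move=> t /=; rewrite !fctE; have [->|] := eqVneq (f t) 0; last by left.
  by rewrite sub0r oppr_eq0; right.
by rewrite finite_setU.
Qed.

Let fsumrB (f g : V -> G) :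
  finite_set [set v | f v != 0] -> finite_set [set v | g v != 0] ->
  \sum_(v \in [set: V]) (f v - g v) =
  \sum_(v \in [set: V]) f v - \sum_(v \in [set: V]) g v.
Proof.
move=> ff fg; set A := [set v | f v != 0] `|` [set v | g v != 0].
have fA : finite_set A by rewrite finite_setU.
have out v : (~` A) v -> f v = 0 /\ g v = 0.
  by move=> /not_orP[/negP/negPn/eqP -> /negP/negPn/eqP ->].
rewrite -!(@fsbig_widen _ _ _ _ A setT)//.
- by rewrite !fsbig_finite// sumrB.
- by move=> v [_ /out[]].
- by move=> v [_ /out[]].
- by move=> v [_ /out[/= -> ->]]; rewrite subrr.
Qed.

Let finite_slice (T : choiceType) (f : V * T -> G) (t : T) :
  finite_set [set p | f p != 0] -> finite_set [set v | f (v, t) != 0].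
Proof.
move=> /(finite_image fst); apply: sub_finite_set => v /= fv.
by exists (v, t).
Qed.

Let finite_slice2 (d : V * V * V -> G) (p : V * V) :
  finite_set [set q | d q != 0] -> finite_set [set v | d (v, p.1, p.2) != 0].
Proof.
move=> /(finite_image (fun q => q.1.1)); apply: sub_finite_set => v /= dv.
by exists (v, p.1, p.2).
Qed.

Section groups.
Context K.

Definition is_cycle1 : {pred V * V -> G} := fun c =>
  `[< chain1 K c /\ forall x, boundary1 c x = 0 >].

Let is_cycle1_zmod_closed : zmod_closed is_cycle1.
Proof.
split=> [|c c' /asboolP[[fc Kc ac dc] bc] /asboolP[[fc' Kc' ac' dc'] bc']].
  apply/asboolP; split=> [|x]; last by apply: fsbig1.
  split=> [|x y|x y|x]; rewrite ?fctE ?oppr0 ?eqxx//.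
  by apply: (@sub_finite_set _ _ set0) => // p /=; rewrite eqxx.
apply/asboolP; split=> [|x]; first split.
- exact: finite_suppB.
- move=> x y; rewrite !fctE; have [->|/Kc//] := eqVneq (c (x, y)) 0.
  by rewrite sub0r oppr_eq0 => /Kc'.
- by move=> x y; rewrite !fctE ac ac' opprB opprK addrC.
- by move=> x; rewrite !fctE dc dc' subrr.
- have := fsumrB (finite_slice x fc) (finite_slice x fc').
  by rewrite -/(boundary1 c x) -/(boundary1 c' x) bc bc' subrr.
Qed.

HB.instance Definition _ := GRing.isZmodClosed.Build (V * V -> G) is_cycle1
  is_cycle1_zmod_closed.

Record cycle1 := Cycle1 { cycle1_val : V * V -> G; _ : cycle1_val \in is_cycle1 }.

HB.instance Definition _ := [isSub for cycle1_val].
HB.instance Definition _ := [Choice of cycle1 by <:].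
HB.instance Definition _ := [SubChoice_isSubZmodule of cycle1 by <:].

Definition is_boundary1 : {pred cycle1} := fun z =>
  `[< exists2 d, chain2 K d & forall p, boundary2 d p = val z p >].

Let is_boundary1_zmod_closed : zmod_closed is_boundary1.
Proof.
split=> [|z z' /asboolP[d [fd Kd ad dd] bd] /asboolP[d' [fd' Kd' ad' dd'] bd']].
  apply/asboolP; exists (fun=> 0); last by move=> p; exact: fsbig1.
  split=> [|x y z|x y z|x y]; rewrite ?oppr0 ?eqxx//.
  by apply: (@sub_finite_set _ _ set0) => // p /=; rewrite eqxx.
apply/asboolP; exists (d - d'); first split.
- exact: finite_suppB.
- move=> x y w; rewrite !fctE; have [->|/Kd//] := eqVneq (d (x, y, w)) 0.
  by rewrite sub0r oppr_eq0 => /Kd'.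
- move=> x y w; have [e1 e2] := ad x y w; have [e1' e2'] := ad' x y w.
  by rewrite !fctE e1 e2 e1' e2' opprB opprK addrC.
- by move=> x y; rewrite !fctE dd dd' subrr.
- move=> p; rewrite raddfB /= !fctE -bd -bd'.
  exact: (fsumrB (finite_slice2 p fd) (finite_slice2 p fd')).
Qed.

HB.instance Definition _ := GRing.isZmodClosed.Build cycle1 is_boundary1
  is_boundary1_zmod_closed.

Definition H1 := Quotient.quot is_boundary1.

HB.instance Definition _ := GRing.Zmodule.on H1.

End groups.

Section induced_map.
Context K L (KL : subcomplex K L).

Let chain1_incl c : chain1 K c -> chain1 L c.
Proof. by case=> fc Kc ac dc; split=> // x y /Kc/KL. Qed.

Let chain2_incl d : chain2 K d -> chain2 L d.
Proof. by case=> fd Kd ad dd; split=> // x y z /Kd/KL. Qed.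

Let cycle1_incl_subproof (z : cycle1 K) : val z \in is_cycle1 L.
Proof.
by case: z => c /= /asboolP[Kc bc]; apply/asboolP; split=> //; exact: chain1_incl.
Qed.

Definition cycle1_incl (z : cycle1 K) : cycle1 L := Cycle1 (cycle1_incl_subproof z).

Definition H1_map (a : H1 K) : H1 L := \pi_(H1 L) (cycle1_incl (repr a)).

Lemma H1_map_pi (z : cycle1 K) :
  H1_map (\pi_(H1 K) z) = \pi_(H1 L) (cycle1_incl z).
Proof.
apply/eqP; rewrite /H1_map -Quotient.idealrBE.
have : repr (\pi_(H1 K) z) - z \in is_boundary1 (K := K).
  by rewrite Quotient.idealrBE reprK.
move=> /asboolP[d Kd bd]; apply/asboolP; exists d; first exact: chain2_incl.
by move=> p; rewrite bd !raddfB.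
Qed.

Let H1_map_zmod_morphism : zmod_morphism H1_map.
Proof.
move=> a b; rewrite -[a]reprK -[b]reprK -raddfB !H1_map_pi -raddfB.
by congr (\pi_(H1 L) _); apply/val_inj; rewrite !raddfB.
Qed.

HB.instance Definition _ := GRing.isZmodMorphism.Build (H1 K) (H1 L) H1_map
  H1_map_zmod_morphism.

End induced_map.

End homology.

Section geodesic.
Context {R : realType} {X : metricType R}.

Definition path_length (f : R -> X) : \bar R :=
  ereal_sup [set (\sum_(n < size s)
                    mdist (f (nth 1 (0 :: s) n)) (f (nth 1 (0 :: s) n.+1)))%:E
            | s in itv_partition 0 1].

End geodesic.

Definition geodesic {R : realType} (X : metricType R) := forall x y : X,
  exists f : R -> X, [/\ {within `[0, 1]%classic, continuous f},
    f 0 = x, f 1 = y & path_length f = (mdist x y)%:E].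

Definition dense_within {R : realType} {X : metricType R} (s : R) (S : set X) :=
  forall x : X, exists2 y, S y & mdist x y < s.

Section rips.
Context {R : realType} {X : metricType R}.
Implicit Types (A B : set X) (p q : R).

Definition diameter (s : set X) : R :=
  sup [set mdist xy.1 xy.2 | xy in s `*` s].

Let diameter_has_ubound (s : set X) : finite_set s ->
  has_ubound [set mdist xy.1 xy.2 | xy in s `*` s].
Proof.
move=> fs; have /finite_fsetP[t ->] : finite_set [set mdist xy.1 xy.2 | xy in s `*` s].
  by apply: finite_image; exact: finite_setX.
exists (\sum_(u <- finmap.enum_fset t) `|u|) => u /= ut.
rewrite (le_trans (ler_norm u))// (big_rem u)//= lerDl.
by apply: sumr_ge0.
Qed.

Lemma diameter_le (s t : set X) :
  finite_set s -> t !=set0 -> t `<=` s -> diameter t <= diameter s.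
Proof.
move=> fs [x tx] ts; apply: ge_sup; first by exists (mdist x x), (x, x).
move=> _ [[y z] [/= /ts sy /ts sz] <-].
by apply: ub_le_sup; [exact: diameter_has_ubound|exists (y, z)].
Qed.

Lemma diameter1 (x : X) : diameter [set x] = 0.
Proof.
rewrite /diameter (_ : [set _ | _ in _] = [set 0]) ?sup1//.
apply/seteqP; split=> [_ [[y z] [/= -> ->] <-]|_ /= ->]; first exact: mdistxx.
by exists (x, x) => //; exact: mdistxx.
Qed.

Definition rips_simplex A p (s : set X) :=
  [/\ finite_set s, s !=set0, s `<=` A & diameter s < p].

Let rips_finite A p s : rips_simplex A p s -> finite_set s.
Proof. by case. Qed.

Let rips_neq0 A p s : rips_simplex A p s -> s !=set0.
Proof. by case. Qed.

Let rips_face A p s t :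
  rips_simplex A p s -> t `<=` s -> t !=set0 -> rips_simplex A p t.
Proof.
move=> [fs _ sA sp] ts t0; split=> //.
- exact: sub_finite_set fs.
- exact: subset_trans sA.
- by rewrite (le_lt_trans _ sp)// diameter_le.
Qed.

Definition rips A p : simplicial_complex X :=
  SimplicialComplex (@rips_finite A p) (@rips_neq0 A p) (@rips_face A p).

Lemma rips_sub A B p q : A `<=` B -> p <= q -> subcomplex (rips A p) (rips B q).
Proof.
move=> AB pq s [fs s0 sA sp]; split=> //; first exact: subset_trans AB.
exact: lt_le_trans pq.
Qed.

Lemma rips_vertex A p x : A x -> 0 < p -> rips A p [set x].
Proof.
move=> Ax p0; split; [exact: finite_set1|by exists x|by move=> _ ->|].
by rewrite diameter1.
Qed.

Definition pi1_rips A p x (Ax : A x) (p0 : 0 < p) : groupType :=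
  pi1 R (vertex R (rips_vertex Ax p0)).

Definition pi1_rips_map A B p q x (Ax : A x) (Bx : B x) (p0 : 0 < p) (q0 : 0 < q)
    (AB : A `<=` B) (pq : p <= q) :
    {multiplicative pi1_rips Ax p0 -> pi1_rips Bx q0} :=
  pi1_map (@realization_incl_continuous R _ _ _ (rips_sub AB pq))
    (realization_incl_vertex R (rips_sub AB pq) (rips_vertex Ax p0)
      (rips_vertex Bx q0)).

Definition H1_rips_map (G : zmodType) A B p q (AB : A `<=` B) (pq : p <= q) :
    {additive H1 G (rips A p) -> H1 G (rips B q)} :=
  H1_map (rips_sub AB pq).

End rips.

Section persistence.
Context {R : realType} {X : metricType R}.

Definition pi1_bonding (x : X) p q (p0 : 0 < p) (q0 : 0 < q) (pq : p <= q) :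
    {multiplicative pi1_rips (A := setT) (x := x) I p0
                 -> pi1_rips (A := setT) (x := x) I q0} :=
  pi1_rips_map I I p0 q0 (subsetT setT) pq.

Definition H1_bonding (G : zmodType) p q (pq : p <= q) :
    {additive H1 G (rips [set: X] p) -> H1 G (rips [set: X] q)} :=
  H1_rips_map G (subsetT setT) pq.

Definition mu_pi1 (S : set X) r x (Sx : S x) (r0 : 0 < r) :
    {multiplicative pi1_rips Sx r0 -> pi1_rips (A := setT) (x := x) I r0} :=
  pi1_rips_map Sx I r0 r0 (@subsetT _ S) (lexx r).

Definition mu_H1 (G : zmodType) (S : set X) r :
    {additive H1 G (rips S r) -> H1 G (rips [set: X] r)} :=
  H1_rips_map G (@subsetT _ S) (lexx r).

Definition pi1_bonding_iso (x : X) (p q : R) :=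
  exists (p0 : 0 < p) (q0 : 0 < q) (pq : p <= q),
    bijective (pi1_bonding x p0 q0 pq).

Definition H1_bonding_iso (G : zmodType) (p q : R) :=
  exists pq : p <= q, bijective (H1_bonding G pq).

End persistence.

Section critical_values.
Context {R : realType}.
Implicit Types (iso : R -> R -> Prop) (p r c : R).

Definition left_critical iso p := \forall e \near 0^'+, ~ iso (p - e) p.

Definition right_critical iso p := forall e, 0 < e -> ~ iso p (p + e).

Definition critical_value iso p :=
  0 < p /\ (left_critical iso p \/ right_critical iso p).

Definition critical_threshold iso r c :=
  [/\ critical_value iso c, c < r &
      forall c', critical_value iso c' -> c' < r -> c' <= c] \/
  (~ (exists2 c', critical_value iso c' & c' < r) /\ 0 < c < r).

End critical_values.

(* Main.v *)
Require Import Defs.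
From HB Require Import structures.
From mathcomp Require Import all_boot all_order all_algebra.
From mathcomp Require Import finmap generic_quotient ring_quotient lra zify.
From mathcomp Require Import all_classical all_reals all_analysis.

Set Implicit Arguments.
Unset Strict Implicit.
Unset Printing Implicit Defensive.

Import Order.TTheory GRing.Theory Num.Theory.
Import numFieldNormedType.Exports.

Local Open Scope classical_set_scope.
Local Open Scope ring_scope.

(** Since [S] is finer than [(r - c) / 2] and [X] is compact, [S] is even
    [e]-dense for some [e < (r - c) / 2]. Let [p] be [r - 2 * e], so that
    [c < p < r], and let [f] move each point of [X] by less than [e] into [S],
    leaving [S] fixed. Distances grow by less than [2 * e] under [f], hence [f] is
    a simplicial map from [rips [set: X] p] to [rips S r]; followed by the
    inclusion into [rips [set: X] r] it is contiguous to the inclusion of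
    [rips [set: X] p].

    There is no critical value in the open interval from [c] to [r], and this
    makes the bonding map from scale [p] to scale [r] an isomorphism. It is
    surjective because [X] is geodesic: an edge of length less than [r] can be
    subdivided along a geodesic ([rips_edge_subdivision]). It is injective by
    [threshold_injective]: what dies at a scale [q] already dies before [q], simplices
    being defined by a strict inequality, so that the supremum of the scales up to
    which nothing from scale [p] dies is attained, and this supremum would be right
    critical if it were smaller than [r].

    Surjectivity of the map induced by [S] follows: a class at scale [r] comes from
    scale [p], where [f] moves it into [S]. For injectivity, a loop in [rips S r] is
    subdivided into a loop [u] with steps shorter than [p]. The point is that not
    only [u] but also its image under [f] is homotopic to the original loop, the
    latter inside [rips S r]: if [m] is a midpoint of an edge from [x] to [y], then
    the subdivision of the half from [x] to [m] stays within [r / 2 + e < r] of [x]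
    after [f] has been applied, so [x] can be coned off, and likewise [y]
    ([sample_edge]). If the loop dies in [rips [set: X] r], then so does [u], then
    [u] dies at scale [p], and [f] carries this into [rips S r].

    These arguments are about edge paths, that is words in the vertices, up to
    replacing two sides of a triangle by the third. For the fundamental group
    of the realization, the translation is [pi1_inclusion_bijective]. It rests on
    simplicial approximation: a path, or a homotopy, is sampled on a grid so fine
    that around each grid point it stays in the open star of a vertex, and that
    vertex becomes a letter. The weak topology causes no trouble because a compact
    set meets only finitely many open simplices ([compact_support]). For homology,
    [word_chain] sends equivalent words to homologous chains, every cycle is a sum
    of edges, to which the subdivision of edges applies, and [f] acts on chains by
    [push1]. *)

(** * Edge paths *)

Section edge_words.
Context {V : choiceType}.
Implicit Types (K L : simplicial_complex V) (s : set V) (w u : seq V).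

Lemma simplex2 K s x y : K s -> s x -> s y -> K [set x; y].
Proof.
move=> Ks sx sy; apply: (simplex_face Ks); last by exists x; left.
by move=> _ [->|->].
Qed.

Lemma simplex3 K s x y z : K s -> s x -> s y -> s z -> K [set x; y; z].
Proof.
move=> Ks sx sy sz; apply: (simplex_face Ks); last by exists x; left; left.
by move=> _ [[->|->]|->].
Qed.

Definition edge K : rel V := fun x y => `[< K [set x; y] >].

Lemma simplex_edge K s x y : K s -> s x -> s y -> edge K x y.
Proof. by move=> Ks sx sy; apply/asboolP; exact: simplex2 Ks sx sy. Qed.

(** Homotopy of edge paths with fixed end points. Words that are not edge paths
    are allowed; equivalence does not change whether a word is a loop, by
    [edge_equiv_loop]. *)
Inductive edge_equiv K : seq V -> seq V -> Prop :=
| edge_refl w : edge_equiv K w w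
| edge_sym w w' : edge_equiv K w w' -> edge_equiv K w' w
| edge_trans w w' w'' : edge_equiv K w w' -> edge_equiv K w' w'' ->
    edge_equiv K w w''
| edge_triangle w x y z u : K [set x; y; z] ->
    edge_equiv K (w ++ [:: x, y, z & u]) (w ++ [:: x, z & u]).

Lemma edge_equiv_sub K L w w' :
  subcomplex K L -> edge_equiv K w w' -> edge_equiv L w w'.
Proof.
move=> KL; elim=> {w w'} [w|w w' _|w w' w'' _ IH _ /(edge_trans IH)|w x y z u /KL]//.
- exact: edge_refl.
- exact: edge_sym.
- exact: edge_triangle.
Qed.

Lemma edge_equiv_cat K a w w' u :
  edge_equiv K w w' -> edge_equiv K (a ++ w ++ u) (a ++ w' ++ u).
Proof.
elim=> {w w'} [w|w w' _|w w' w'' _ IH _ /(edge_trans IH)|w x y z v Kxyz]//.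
- exact: edge_refl.
- exact: edge_sym.
- by rewrite -!catA !(catA a) /=; exact: edge_triangle.
Qed.

Lemma edge_equiv_catr K w w' u :
  edge_equiv K w w' -> edge_equiv K (w ++ u) (w' ++ u).
Proof. exact: (@edge_equiv_cat K [::]). Qed.

Lemma edge_equiv_catl K a w w' :
  edge_equiv K w w' -> edge_equiv K (a ++ w) (a ++ w').
Proof. by move=> /(@edge_equiv_cat K a _ _ [::]); rewrite !cats0. Qed.

Lemma edge_equiv_cons K x w w' :
  edge_equiv K w w' -> edge_equiv K (x :: w) (x :: w').
Proof. exact: (@edge_equiv_catl K [:: x]). Qed.

(** Being a closed edge path based at [b]. At least two entries are required,
    so that the constant loop is [[:: b; b]] and the triangle rule alone removes
    repeated letters. *)
Definition edge_loop K (b : V) w :=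
  [&& (1 < size w)%N, head b w == b, last b w == b & sorted (edge K) w].

Lemma edge_equiv_loop K b w w' :
  edge_equiv K w w' -> edge_loop K b w = edge_loop K b w'.
Proof.
elim=> {w w'} [w|w w' _|w w' w'' _ -> _ ->|w x y z u Kxyz]//.
have exy : edge K x y by apply: (simplex_edge Kxyz); [left; left|left; right].
have eyz : edge K y z by apply: (simplex_edge Kxyz); [left; right|right].
have exz : edge K x z by apply: (simplex_edge Kxyz); [left; left|right].
rewrite /edge_loop !size_cat !last_cat /= !addnS !ltnS /=.
case: w => [|a w] /=; first by rewrite exy eyz exz.
by rewrite !cat_path /= exy eyz exz.
Qed.

Lemma edge_equiv_cone K x y w :
  path (fun a c => `[< K [set x; a; c] >]) y w ->
  edge_equiv K [:: x, y & w] [:: x; last y w].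
Proof.
elim: w y => [|z w IH] y /=; first by move=> _; exact: edge_refl.
move=> /andP[/asboolP Kxyz /IH]; apply: edge_trans.
exact: (edge_triangle [::] w Kxyz).
Qed.

Lemma edge_equiv_cocone K x y w :
  path (fun a c => `[< K [set a; c; y] >]) x w ->
  edge_equiv K ((x :: w) ++ [:: y]) [:: x; y].
Proof.
elim: w x => [|z w IH] x /=; first by move=> _; exact: edge_refl.
move=> /andP[/asboolP Kxzy /IH]/(edge_equiv_cons x)/edge_trans; apply.
exact: (edge_triangle [::] [::] Kxzy).
Qed.

Lemma edge_equiv_dupl K x y w :
  edge K x y -> edge_equiv K [:: x, x, y & w] [:: x, y & w].
Proof.
move=> /asboolP Kxy; apply: (edge_triangle [::]).
by apply: (simplex3 Kxy); [left|left|right].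
Qed.

Lemma edge_equiv_dupr K x y w :
  edge K x y -> edge_equiv K (w ++ [:: x; y; y]) (w ++ [:: x; y]).
Proof.
move=> /asboolP Kxy; apply: edge_triangle.
by apply: (simplex3 Kxy); [left|right|right].
Qed.

(** Two edge paths moving in parallel are related by the usual prism, each
    square of which is cut into two triangles; the first path is continued to
    the end of the second. *)
Lemma edge_equiv_prism K b x w x' w' : size w = size w' ->
  (forall i, (i < size w)%N ->
     K [set nth b (x :: w) i; nth b (x :: w) i.+1; nth b (x' :: w') i.+1] /\
     K [set nth b (x :: w) i; nth b (x' :: w') i; nth b (x' :: w') i.+1]) ->
  edge_equiv K ((x :: w) ++ [:: last x' w']) [:: x, x' & w'].
Proof.
elim: w w' x x' => [|y w IH] [|y' w'] x x' //=; first by move=> *; exact: edge_refl.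
move=> [sw] Kw; have [Kxyy' Kxx'y'] := Kw 0%N isT.
have /(edge_equiv_cons x)/edge_trans := IH w' y y' sw (fun i iw => Kw i.+1 iw).
apply; apply: edge_trans (edge_triangle [::] w' Kxyy') _.
exact/edge_sym/(edge_triangle [::] w' Kxx'y').
Qed.

(** Homotopies through loops, one letter at a time. The prism adds a letter [b]
    at the end of [w] and one at the beginning of [w'], which are removed as
    repetitions. *)
Lemma edge_equiv_parallel K b w w' :
  edge_loop K b w -> edge_loop K b w' -> size w = size w' ->
  (forall i, (i.+1 < size w)%N ->
     K [set nth b w i; nth b w i.+1; nth b w' i.+1] /\
     K [set nth b w i; nth b w' i; nth b w' i.+1]) ->
  edge_equiv K w w'.
Proof.
move=> /and4P[] + + + +/and4P[].
case: w w' => [|x [|y w]] [|x' [|y' w']] // _ /eqP /= ->{x} lw pw _ /eqP ->{x'}.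
move=> lw' pw' sw Kw.
have := @edge_equiv_prism K b b (y :: w) b (y' :: w') _ Kw; rewrite /= (eqP lw').
move=> H; apply: edge_trans (edge_trans (H _) _); last first.
- by apply: edge_equiv_dupl; case/andP: pw'.
- by case: sw => ->.
- apply: edge_sym; rewrite -cat_cons; move: lw pw.
  case/lastP: w {sw Kw H} => [/= /eqP ->|w z].
    by rewrite andbT => bb; exact: (@edge_equiv_dupr K b b [::]).
  rewrite last_rcons => /eqP ->; rewrite -!cat_cons -cats1 -!cat_cons.
  case/lastP: w => [|w z'] /=.
    by rewrite andbT => /andP[_ yb]; exact: (@edge_equiv_dupr K y b [:: b]).
  rewrite -cats1 -!catA /= cat_path /= andbT => /and3P[_ _ /andP[_ zb]].
  by rewrite -!cat_cons; exact: edge_equiv_dupr.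
Qed.

Fixpoint stretch (k : nat) (x : V) w : seq V :=
  if w is y :: w' then nseq k x ++ stretch k y w' else [:: x].

Lemma size_stretch k x w : size (stretch k x w) = (size w * k).+1.
Proof.
by elim: w x => //= y w IH x; rewrite size_cat size_nseq IH mulSn addnS.
Qed.

Lemma nth_stretch b k x w i : (0 < k)%N -> (i <= size w * k)%N ->
  nth b (stretch k x w) i = nth b (x :: w) (i %/ k)%N.
Proof.
move=> k0; elim: w x i => [|y w IH] x i /=.
  by rewrite leqn0 => /eqP ->; rewrite div0n.
rewrite nth_cat size_nseq nth_nseq mulSn.
have [ik|ki] := ltnP i k; first by rewrite divn_small.
move=> ik; rewrite IH ?leq_subLR//; have -> // : (i %/ k = ((i - k) %/ k).+1)%N.
by rewrite -{1}(subnK ki) divnDr// divnn k0 addn1.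
Qed.

Lemma edge_equiv_stretch K k x w : (0 < k)%N -> path (edge K) x w ->
  edge_equiv K (stretch k x w) (x :: w).
Proof.
move=> k0; elim: w x => [|y w IH] x /=; first by move=> _; exact: edge_refl.
move=> /andP[xy /IH yw]; apply: edge_trans (edge_equiv_catl _ yw) _.
case: k k0 {IH yw} => // k _; elim: k => [|k IH]; first exact: edge_refl.
apply: edge_trans IH; case: k => [|k] /=; first exact: edge_equiv_dupl.
apply: edge_equiv_dupl; move: xy => /asboolP xy.
by apply: (simplex_edge xy); left.
Qed.

(** A loop of [m * k] edges which spends its [j]-th block of [k] edges on the
    [j]-th edge of [w] runs in parallel to [w] with its letters repeated. *)
Lemma edge_equiv_refine K b k m w u : (0 < k)%N ->
  edge_loop K b w -> edge_loop K b u -> size w = m.+1 -> size u = (m * k).+1 ->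
  (forall i j, (j < m)%N -> (j * k <= i <= j.+1 * k)%N ->
     nth b u i = nth b w j \/ nth b u i = nth b w j.+1) ->
  edge_equiv K u w.
Proof.
move=> k0 lw lu + su uw; case: w lw uw => // x w lw uw [sw].
have pw : path (edge K) x w by case/and4P: lw.
have sw' := edge_equiv_stretch k0 pw.
apply: edge_trans (sw'); apply: (@edge_equiv_parallel _ b) => //.
- by rewrite (edge_equiv_loop _ sw').
- by rewrite su size_stretch sw.
rewrite su => i; rewrite ltnS => im; set j := (i %/ k)%N.
have jm : (j < m)%N by rewrite ltn_divLR.
have /andP[ji ij] : (j * k <= i < j.+1 * k)%N.
  by rewrite leq_trunc_div -ltn_divLR// ltnSn.
have Kj : K [set nth b (x :: w) j; nth b (x :: w) j.+1].
  by have /(pathP b)/(_ j) := pw; rewrite sw => /(_ jm)/asboolP.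
rewrite !nth_stretch ?sw -/j; [|lia..].
set s := [set _; _] in Kj.
suff [? ? ? ?] : [/\ s (nth b u i), s (nth b u i.+1),
    s (nth b (x :: w) j) & s (nth b (x :: w) (i.+1 %/ k)%N)].
  by split; exact: simplex3 Kj _ _ _.
split.
- by apply: uw => //; lia.
- by apply: uw => //; lia.
- by left.
- have : (j <= i.+1 %/ k <= j.+1)%N.
    by rewrite leq_div2r//= -ltnS ltn_divLR//; lia.
  have [->|ne /andP[a c]] := eqVneq (i.+1 %/ k)%N j; first by left.
  suff -> : (i.+1 %/ k)%N = j.+1 by right.
  by apply/eqP; rewrite eqn_leq c ltn_neqAle eq_sym ne a.
Qed.

End edge_words.

(** Simplicial maps preserve homotopy of edge paths. *)
Lemma edge_equiv_map (V W : choiceType) (K : simplicial_complex V)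
    (L : simplicial_complex W) (f : V -> W) (w w' : seq V) :
  (forall x y z, K [set x; y; z] -> L [set f x; f y; f z]) ->
  edge_equiv K w w' -> edge_equiv L (map f w) (map f w').
Proof.
move=> KL; elim=> {w w'} [w|w w' _|w w' w'' _ IH _ /(edge_trans IH)|w x y z u /KL] //.
- exact: edge_refl.
- exact: edge_sym.
- by rewrite !map_cat; exact: edge_triangle.
Qed.

(** * Compactness in the weak topology *)

Section realization_topology.
Context {R : realType} {V : choiceType} {K : simplicial_complex V}.
Implicit Types (t u : realization R K) (v : V) (e : R).

Definition support t : set V := [set v | t v != 0].

Lemma support_simplex t : K (support t).
Proof. by case: t => t []. Qed.

Lemma open_coordinate (a : R) v e : open [set t : realization R K | `|a - t v| < e].
Proof.
rewrite open_realizationE => s Ks t st /= ate.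
exists (e - `|a - t v|) => [|u su /(_ v)]; first by rewrite subr_gt0.
by rewrite ltrBrDl; apply: le_lt_trans; rewrite (le_trans _ (ler_normD _ _))// subrKA.
Qed.

Lemma coordinate_continuous v : continuous (fun t : realization R K => t v).
Proof.
move=> t; apply/(@cvgrPdist_lt _ _ _ (nbhs t) (nbhs_filter t)) => e e0.
apply: (@open_nbhs_nbhs _ t [set u : realization R K | `|t v - u v| < e]).
by split; [exact: open_coordinate|rewrite /= subrr normr0].
Qed.

Lemma open_star v : open [set t : realization R K | support t v].
Proof.
rewrite openE => t /= tv; have t0 : 0 < `|t v| by rewrite normr_gt0.
suff : \forall u \near t, support u v by [].
have /(@cvgrPdist_lt _ _ _ (nbhs t) (nbhs_filter t))/(_ _ t0) := @coordinate_continuous v t.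
apply: (@filterS _ (nbhs t) (nbhs_filter t)) => u; rewrite /support /=.
apply: contraTneq => ->.
by rewrite subr0 ltxx.
Qed.

(** On finitely many vertices only finitely many simplices are involved, so the
    weak topology is the Euclidean one there. *)
Lemma continuous_finite_support (Z : topologicalType) (A : set Z) (F : set V)
    (f : Z -> realization R K) :
  finite_set F -> (forall z, A z -> support (f z) `<=` F) ->
  (forall v, {within A, continuous (fun z => f z v)}) ->
  {within A, continuous f}.
Proof.
move=> /finite_fsetP[F' FF'] fF cf; apply/subspace_continuousP => z Az U.
rewrite nbhsE => -[B [oB Bfz] BU].
have cv v e : 0 < e -> \forall y \near within A (nbhs z), `|f z v - f y v| < e.
  by have /subspace_continuousP/(_ z Az)/cvgrPdist_lt := cf v; apply.
have coords e : 0 < e -> \forall y \near within A (nbhs z), A y /\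
    forall v, `|f z v - f y v| < e.
  move=> e0.
  have : \forall y \near within A (nbhs z), forall v, v \in F' -> `|f z v - f y v| < e.
    have : (within A (nbhs z)) (\bigcap_(v in [set` F']) [set y | `|f z v - f y v| < e]).
      by apply: filter_bigI => v _; exact: cv.
    by apply: filterS => y /= H v vF; exact: H.
  move=> H; have : \forall y \near within A (nbhs z), A y by exact: withinT.
  apply: filterS2 H => y yF Ay; split=> // v.
  have [/yF//|vF] := boolP (v \in F').
  have out x : A x -> f x v = 0.
    by move=> /fF/(_ v) H; apply/eqP/negP => /negP/H; rewrite FF' /= (negbTE vF).
  by rewrite !out// subrr normr0.
(* [D] is a possible carrier of the nearby points [f y]. If it does not contain
   the carrier of [f z], then the points near [f z] have another carrier; if it does,
   the radius comes from the definition of the weak topology on that face. *)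
have faces (D : {fset V}) : \forall y \near within A (nbhs z),
    support (f y) = [set` D] -> B (f y).
  have [[KD zD]|nD] := pselect (K [set` D] /\ support (f z) `<=` [set` D]).
    have := oB; rewrite open_realizationE => /(_ _ KD (f z) zD Bfz)[e e0 eB].
    apply: filterS (coords e e0) => y [_ ye] yD; apply: eB => //.
    by rewrite /closed_simplex /= -/(support (f y)) yD.
  have [KD|KD] := pselect (K [set` D]); last first.
    by near=> y => yD; case: KD; rewrite -yD; exact: support_simplex.
  have /existsNP[v /not_implyP[zv nDv]] : ~ support (f z) `<=` [set` D] by tauto.
  have z0 : 0 < `|f z v| by rewrite normr_gt0.
  apply: filterS (cv v _ z0) => y + yD; rewrite (_ : f y v = 0) ?subr0 ?ltxx//.
  by apply/eqP/negP => /negP fy; apply: nDv; rewrite -yD.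
have : (within A (nbhs z)) (\bigcap_(D in [set` fpowerset F'])
    [set y | support (f y) = [set` D] -> B (f y)]).
  by apply: filter_bigI => D _; exact: faces.
move=> H; have : \forall y \near within A (nbhs z), A y by exact: withinT.
apply: filterS2 H => y yO Ay; apply: BU.
have fy : finite_set (support (f y)) by apply: sub_finite_set (fF y Ay) _; rewrite FF'.
apply: (yO (fset_set (support (f y)))); last by rewrite fset_setK.
rewrite /= fpowersetE; apply/fsubsetP => v; rewrite in_fset_set// inE => /(fF y Ay).
by rewrite FF'.
Unshelve. all: by end_near.
Qed.

Lemma separated_from_finite (P : set (realization R K)) t : finite_set P ->
  exists2 e : R, 0 < e &
    forall u, P u -> (forall v, `|t v - u v| < e) -> u = t.
Proof.
move=> /finite_fsetP[P' ->].
pose Q u (e : R) := (forall v, `|t v - u v| < e) -> u = t.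
have : (0 : R)^'+ (\bigcap_(u in [set` P']) Q u).
  apply: filter_bigI => u _; rewrite /Q.
  have [utE|ut] := pselect (u =1 t); first by near=> e => _; exact: realization_eq.
  move/existsNP : ut => [v /eqP utv].
  have d0 : 0 < `|t v - u v| by rewrite normr_gt0 subr_eq0 eq_sym.
  near=> e => /(_ v); rewrite ltNge => /negP[].
  by near: e; exact: nbhs_right_le.
move=> PQ; have : \forall e \near (0 : R)^'+, 0 < e by exact: nbhs_right_gt.
move=> /(filterI PQ)/filter_ex[e [eQ e0]].
by exists e => // u uP; exact: eQ.
Unshelve. all: by end_near. Qed.

(** A choice of one point of [C] over each vertex met by [C] is a closed
    discrete subset of [C], because each simplex contains only finitely many of
    these points. *)
Lemma compact_support (C : set (realization R K)) :
  compact C -> finite_set (\bigcup_(t in C) support t).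
Proof.
move=> cC; set W := \bigcup_(t in C) support t.
have [[w0 [t0 Ct0 _]]|W0] := pselect (W !=set0); last first.
  by move/set0P/negP/negPn/eqP : W0 => ->; exact: finite_set0.
have /choice[g gP] : forall v, exists t, W v -> C t /\ support t v.
  move=> v; have [[t Ct tv]|nv] := pselect (W v); first by exists t.
  by exists t0.
pose A := g @` W.
pose U a := ~` (A `\` [set a]).
have oU a : open (U a).
  rewrite open_realizationE => s Ks t st Ut.
  have [e e0 eP] := separated_from_finite t (finite_image g (simplex_finite Ks)).
  exists e => // u su tu [[v Wv gvu] ua]; apply: Ut.
  have ut : u = t.
    apply: eP => //; exists v => //; apply: su; rewrite -gvu.
    exact: (gP v Wv).2.
  by rewrite -ut; split=> //; exists v.
(* Otherwise an injective sequence in [A] has a cluster point [x], but [U x]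
   contains no point of the sequence other than [x]. *)
have finA : finite_set A.
  apply: contrapT => /infiniteP/card_leP/unsquash h.
  pose a (n : nat) := \val (h (exist _ n (mem_set (I : [set: nat] n)))).
  have aA n : A (a n) by rewrite /a; exact: set_valP.
  have a_inj m n : a m = a n -> m = n.
    by move=> /val_inj; move/(inj (mem_set I) (mem_set I)) => -[].
  have AC : A `<=` C by move=> _ [v Wv <-]; exact: (gP v Wv).1.
  have [|x [Cx clx]] := cC (a @ \oo) (fmap_proper_filter _ _).
    by exists 0%N => // n _; exact/AC/aA.
  have nUx : nbhs x (U x).
    by apply: (@open_nbhs_nbhs _ x (U x)); split; [exact: oU|move=> -[_]; exact].
  have [N aN] : exists N, forall n, (N <= n)%N -> a n <> x.
    have [[N aN]|nN] := pselect (exists N, a N = x); last first.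
      by exists 0%N => n _ an; apply: nN; exists n.
    by exists N.+1 => n Nn; rewrite -aN => /a_inj nN; rewrite nN ltnn in Nn.
  have [||y [[n Nn yn] Uy]] := clx [set y | exists2 n, (N <= n)%N & y = a n] (U x).
  - by exists N => // n /= Nn; exists n.
  - exact: nUx.
  - by apply: Uy; rewrite yn; split=> //; exact: aN.
apply: (@sub_finite_set _ _ (\bigcup_(t in A) support t)).
  move=> v Wv; exists (g v); first by exists v.
  exact: (gP v Wv).2.
apply: bigcup_finite => // t _.
exact: simplex_finite (support_simplex t).
Qed.

Lemma compact_image_support (Z : topologicalType) (A : set Z)
    (f : Z -> realization R K) : compact A -> {within A, continuous f} ->
  exists2 F : set V, finite_set F & forall z, A z -> support (f z) `<=` F.
Proof.
move=> cA cf; exists (\bigcup_(t in f @` A) support t).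
  exact/compact_support/continuous_compact.
by move=> z Az v fv; exists (f z) => //; exists z.
Qed.

End realization_topology.

(** * Homotopies inside simplices and open stars *)

Lemma within_continuous_eq (U W : topologicalType) (A : set U) (f g : U -> W) :
  (forall u, A u -> f u = g u) -> {within A, continuous f} ->
  {within A, continuous g}.
Proof. by move=> fg; apply: subspace_eq_continuous => u /[!inE] /fg. Qed.

Section real_segment.
Context {R : realType}.

Lemma segment_piece (n : nat) (t : R) : (0 < n)%N -> 0 <= t <= n%:R ->
  exists2 j, (j < n)%N & j%:R <= t <= j.+1%:R.
Proof.
elim: n => // -[_ _|n IH _] /andP[t0 tn]; first by exists 0%N => //; rewrite t0.
have [tn1|nt] := leP t n.+1%:R; last by exists n.+1 => //; rewrite ltW.
have [|j jn jt] := IH isT; first by rewrite t0.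
by exists j => //; exact: leq_trans jn _.
Qed.

Lemma natinv_lt (e : R) : 0 < e -> exists2 N, (0 < N)%N & N%:R^-1 < e.
Proof.
move=> e0; exists (Num.trunc e^-1).+1 => //.
by rewrite invf_plt ?posrE ?ltr0n// truncnS_gt.
Qed.

End real_segment.

Section realization_homotopy.
Context {R : realType} {V : choiceType} {K : simplicial_complex V}.
Implicit Types (t u x : realization R K) (v : V) (e : R).
Local Notation I := (`[0 : R, 1]%classic).
Local Notation square := (`[0 : R, 1]%classic `*` `[0 : R, 1]%classic).

(** The point with coordinates [t]; [x] only makes the function total. *)
Definition realize x (t : V -> R) : realization R K :=
  if pselect (barycentric K t) is left Kt then Realization Kt else x.

Lemma realizeE x (t : V -> R) v : barycentric K t -> realize x t v = t v.
Proof. by rewrite /realize; case: pselect. Qed.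

Lemma barycentric_mix t u s (c : R) : K s -> support t `<=` s ->
  support u `<=` s -> 0 <= c <= 1 ->
  barycentric K (fun v => (1 - c) * t v + c * u v).
Proof.
move=> Ks ts us /andP[c0 c1].
have t0 v : 0 <= t v by case: t {ts} => ? [].
have u0 v : 0 <= u v by case: u {us} => ? [].
have sum1 (y : realization R K) : support y `<=` s -> \sum_(v <- fset_set s) y v = 1.
  move=> ys; rewrite -fsbigTE; first by case: y {ys} => ? [].
  move=> v; rewrite in_fset_set ?inE; last exact: simplex_finite Ks.
  by apply: contraNeq => yv; rewrite inE; exact: ys.
have out (y : realization R K) v : support y `<=` s -> ~ s v -> y v = 0.
  by move=> ys sv; apply/eqP/negP => /negP yv; apply: sv; exact: ys.
have S : \sum_(v \in [set: V]) ((1 - c) * t v + c * u v) = 1.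
  rewrite (@fsbigTE _ _ _ _ (fset_set s)).
    by rewrite big_split /= -!mulr_sumr !sum1// !mulr1 subrK.
  move=> v; rewrite in_fset_set; last exact: simplex_finite Ks.
  by move=> /negP; rewrite inE => sv; rewrite !out// !mulr0 addr0.
split=> //.
- by move=> v; rewrite addr_ge0// mulr_ge0// subr_ge0.
- apply: (simplex_face Ks) => [v|].
    move=> /= vn0; apply: contrapT => sv.
    by move: vn0; rewrite !out// !mulr0 addr0 eqxx.
  apply: contrapT => /forallNP n0; have := oner_neq0 R; rewrite -S => /eqP[].
  by apply: fsbig1 => v _; apply: contrapT => /eqP; exact: n0.
Qed.

Lemma within_coordinate (Z : topologicalType) (A : set Z)
    (f : Z -> realization R K) v :
  {within A, continuous f} -> {within A, continuous (fun z => f z v)}.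
Proof.
move=> cf.
apply: (@within_continuous_comp _ _ _ A f (fun t : realization R K => t v)) => //.
by move=> t _; exact: coordinate_continuous.
Qed.

(** Straight lines between two loops; by compactness everything happens on
    finitely many vertices, where the weak topology causes no trouble. *)
Lemma line_homotopic x (f g : R -> realization R K) :
  is_loop x f -> is_loop x g ->
  (forall z, I z -> exists2 s, K s & support (f z) `<=` s /\ support (g z) `<=` s) ->
  homotopic x f g.
Proof.
move=> [cf f0 f1] [cg g0 g1] fg.
pose H (p : R * R) := realize x (fun v => (1 - p.2) * f p.1 v + p.2 * g p.1 v).
have HE p v : square p -> H p v = (1 - p.2) * f p.1 v + p.2 * g p.1 v.
  move=> [/= /fg[s Ks [fs gs]]]; rewrite in_itv /= => p2.
  by rewrite /H realizeE//; exact: (barycentric_mix Ks).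
have [F fF Ff] := compact_image_support (@segment_compact R 0 1) cf.
have [G fG Gg] := compact_image_support (@segment_compact R 0 1) cg.
have I0 : I 0 by rewrite /= in_itv /= lexx ler01.
have I1 : I 1 by rewrite /= in_itv /= lexx ler01.
exists H; split.
- apply: (@continuous_finite_support _ _ _ _ _ (F `|` G)).
  + by rewrite finite_setU.
  + move=> p sp v; rewrite /support /= HE// => /eqP pv.
    have [fv|/negP/negPn/eqP fv] := pselect (f p.1 v != 0).
      by left; apply: (Ff p.1) => //; exact: sp.1.
    have [gv|/negP/negPn/eqP gv] := pselect (g p.1 v != 0).
      by right; apply: (Gg p.1) => //; exact: sp.1.
    by case: pv; rewrite fv gv !mulr0 addr0.
  + move=> v; apply: (@within_continuous_eq _ _ _
      (fun p : R * R => (1 - p.2) * f p.1 v + p.2 * g p.1 v)).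
      by move=> p sp; rewrite HE.
    have cfst h : {within I, continuous h} ->
        {within square, continuous (fun p : R * R => h p.1 : realization R K)}.
      move=> ch; apply: (@within_comp _ _ _ _ I fst h) => //.
        by apply: continuous_subspaceT => p; exact: cvg_fst.
      by move=> p [].
    have csnd : {within square, continuous (fun p : R * R => p.2)}.
      by apply: continuous_subspaceT => p; exact: cvg_snd.
    move=> p; apply: cvgD; apply: cvgM.
    * by apply: cvgB; [exact: cvg_cst|exact: csnd].
    * exact: (within_coordinate (cfst _ cf)).
    * exact: csnd.
    * exact: (within_coordinate (cfst _ cg)).
- move=> z Iz; split; apply: realization_eq => v; rewrite HE//=.
    by rewrite subr0 mul1r mul0r addr0.
  by rewrite subrr mul0r mul1r add0r.
- move=> c Ic; split; apply: realization_eq => v; rewrite HE//= ?f0 ?f1 ?g0 ?g1;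
    by rewrite -mulrDl subrK mul1r.
Qed.

(** Lebesgue numbers for the cover by open stars. *)
Lemma star_lebesgue_number (Z : pseudoMetricType R) (A : set Z)
    (f : Z -> realization R K) : compact A -> {within A, continuous f} ->
  exists2 e : R, 0 < e & forall z, A z ->
    exists v, forall y, A y -> ball z e y -> support (f y) v.
Proof.
move=> cA /subspace_continuousP cf.
move: cA => /compact_near_coveringP/near_covering_withinP.
move=> /(_ R (0 : R)^'+ (fun e z => exists v, forall y, A y -> ball z e y ->
  support (f y) v)) [z Az|].
- have [v fzv] := simplex_neq0 (support_simplex (f z)).
  have : nbhs (f z) [set t : realization R K | support t v].
    by apply: open_nbhs_nbhs; split=> //; exact: open_star.
  move=> /(cf z Az); rewrite /= nbhs_simpl /within /= => /nbhs_ballP[d /= d0 zd].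
  have d2 : 0 < d / 2 by rewrite divr_gt0.
  exists (ball z (d / 2), [set e | e < d / 2]) => /=.
    by split; [exact: nbhsx_ballx|exact: nbhs_right_lt].
  move=> [y e] /= [zy ed] Ay; exists v => y' Ay' yy'; apply: zd => //.
  rewrite (splitr d); apply: ball_triangle zy _.
  by apply: le_ball yy'; exact: ltW.
- move=> d d0 dP; exists (d / 2); first by rewrite divr_gt0.
  apply: dP; last by rewrite divr_gt0.
  by rewrite /= sub0r normrN gtr0_norm ?divr_gt0// ltr_pdivrMr// ltr_pMr// ltr1n.
Qed.

End realization_homotopy.

(** * Polygons and simplicial approximation of loops *)

Section polygons.
Context {R : realType} {V : choiceType} {K : simplicial_complex V}.
Context {b : V} (Kb : K [set b]).
Implicit Types (v : V) (w u : seq V) (s t : R).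
Local Notation I := (`[0 : R, 1]%classic).
Local Notation square := (`[0 : R, 1]%classic `*` `[0 : R, 1]%classic).
Local Notation base := (vertex R Kb).

(** The translates of [hat] by the integers are a partition of unity. *)
Definition hat t : R := Num.max 0 (1 - `|t|).

Definition polygon_coordinate w t v : R :=
  \sum_(i < size w) hat (t - i%:R) * (nth b w i == v)%:R.

Lemma polygon_coordinateE w j t v : (j.+1 < size w)%N -> j%:R <= t <= j.+1%:R ->
  polygon_coordinate w t v =
  (1 - (t - j%:R)) * (v == nth b w j)%:R + (t - j%:R) * (v == nth b w j.+1)%:R.
Proof.
move=> jw /andP[jt tj]; rewrite /polygon_coordinate.
rewrite -natr1 in tj.
rewrite (bigD1 (Ordinal (ltnW jw)))//= (bigD1 (Ordinal jw))/=; last first.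
  by rewrite -val_eqE /= eqn_leq ltnn.
rewrite big1 ?addr0 => [|i /andP[]]; last first.
  rewrite -!val_eqE /= => ij ij1; rewrite /hat max_l ?mul0r// subr_le0.
  have [ilt|] := ltnP i j.
    have : i%:R + 1 <= j%:R :> R by rewrite natr1 ler_nat.
    by move=> ?; rewrite ger0_norm; lra.
  rewrite leq_eqVlt eq_sym (negbTE ij)/= leq_eqVlt eq_sym (negbTE ij1)/= => ji.
  have : j%:R + 1 + 1 <= i%:R :> R by rewrite !natr1 ler_nat.
  by move=> ?; rewrite ler0_norm; lra.
rewrite (eq_sym v) (eq_sym v) /hat -natr1; congr (_ * _ + _ * _).
  by rewrite ger0_norm ?max_r; lra.
by rewrite ler0_norm ?max_r; lra.
Qed.

Lemma polygon_coordinate_continuous w v :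
  continuous (fun t => polygon_coordinate w t v).
Proof.
apply: continuous_big => [|i _ t]; first exact: add_continuous.
apply: cvgM; last exact: cvg_cst.
apply: (@continuous_max R R (fun=> 0) (fun t => 1 - `|t - i%:R|)).
  exact: cvg_cst.
apply: cvgB; first exact: cvg_cst.
by apply: cvg_norm; apply: cvgB; [exact: cvg_id|exact: cvg_cst].
Qed.

(** The letters of [w] are visited at equally spaced times. *)
Definition polygon w s : realization R K :=
  realize base (polygon_coordinate w ((size w).-1%:R * s)).

Lemma edge_vertexl x y : edge K x y -> K [set x].
Proof.
move=> /asboolP Kxy; apply: (simplex_face Kxy); last by exists x.
by move=> _ ->; left.
Qed.

Lemma polygonE w j s v : sorted (edge K) w -> (j.+1 < size w)%N ->
  j%:R <= (size w).-1%:R * s <= j.+1%:R ->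
  polygon w s v = (1 - ((size w).-1%:R * s - j%:R)) * (v == nth b w j)%:R +
                  ((size w).-1%:R * s - j%:R) * (v == nth b w j.+1)%:R.
Proof.
move=> pw jw js; rewrite /polygon.
have jj : edge K (nth b w j) (nth b w j.+1).
  case: w pw jw {js} => // x w /= pw jw.
  exact: (pathP b pw).
have Kx : K [set nth b w j] := edge_vertexl jj.
have Ky : K [set nth b w j.+1].
  by apply: (@edge_vertexl _ (nth b w j)); rewrite /edge setUC.
have -> : polygon_coordinate w ((size w).-1%:R * s) =
    (fun v => (1 - ((size w).-1%:R * s - j%:R)) * vertex R Kx v +
              ((size w).-1%:R * s - j%:R) * vertex R Ky v).
  by apply/funext => v'; rewrite (polygon_coordinateE _ jw).
rewrite realizeE//; apply: (@barycentric_mix _ _ _ _ _ [set nth b w j; nth b w j.+1]).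
- by apply/asboolP.
- by move=> x; rewrite /support /= pnatr_eq0 eqb0 negbK => /eqP ->; left.
- by move=> x; rewrite /support /= pnatr_eq0 eqb0 negbK => /eqP ->; right.
- by rewrite -natr1 in js; lra.
Qed.

Lemma support_polygon w j s : sorted (edge K) w -> (j.+1 < size w)%N ->
  j%:R <= (size w).-1%:R * s <= j.+1%:R ->
  support (polygon w s) `<=` [set nth b w j; nth b w j.+1].
Proof.
move=> pw jw js v; rewrite /support /= (polygonE _ pw jw js).
have [->|vj] := eqVneq v (nth b w j); first by left.
have [->|vj1] := eqVneq v (nth b w j.+1); first by right.
by rewrite !mulr0 addr0 eqxx.
Qed.

Lemma edge_loop_size w : edge_loop K b w -> (0 < (size w).-1)%N.
Proof. by case/and4P; case: w => // x []. Qed.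

Lemma polygon_piece w s : edge_loop K b w -> I s ->
  exists2 j, (j.+1 < size w)%N & j%:R <= (size w).-1%:R * s <= j.+1%:R.
Proof.
move=> lw; rewrite /= in_itv /= => /andP[s0 s1].
have w0 := edge_loop_size lw.
have [|j jn js] := @segment_piece R (size w).-1 ((size w).-1%:R * s) w0.
  by rewrite mulr_ge0//= ler_piMr.
by exists j => //; case: (size w) jn.
Qed.

Lemma polygon_loop w : edge_loop K b w -> is_loop base (polygon w).
Proof.
move=> lw; have w0 := edge_loop_size lw.
have [sw hw tw pw] := and4P lw.
split.
- apply: (@continuous_finite_support _ _ _ _ _ [set` w]); first exact: finite_seq.
    move=> s /(polygon_piece lw)[j jw js] v /(support_polygon pw jw js)[]->;
    by apply: mem_nth => //; exact: ltnW.
  move=> v; apply: (@within_continuous_eq _ _ _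
      (fun s : R => polygon_coordinate w ((size w).-1%:R * s) v)).
    move=> s /(polygon_piece lw)[j jw js].
    by rewrite (polygonE _ pw jw js) (polygon_coordinateE _ jw).
  apply: continuous_subspaceT => s.
  apply: (@continuous_comp _ _ _ (fun s : R => (size w).-1%:R * s)
    (fun t => polygon_coordinate w t v)).
    by apply: cvgM; [exact: cvg_cst|exact: cvg_id].
  exact: polygon_coordinate_continuous.
- apply: realization_eq => v; rewrite (@polygonE _ 0%N)//; last first.
    by rewrite mulr0 lexx /=.
  by rewrite mulr0 subrr subr0 mul1r mul0r addr0 /= nth0 (eqP hw).
- have [m em] : exists m, size w = m.+2.
    by case: (size w) sw => [|[|m]] // _; exists m.
  have m1 : m%:R <= (size w).-1%:R * (1 : R) <= m.+1%:R.
    rewrite em mulr1; apply/andP; split; rewrite ler_nat; [exact: leqnSn|exact: leqnn].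
  have mw : (m.+1 < size w)%N by rewrite em.
  apply: realization_eq => v; rewrite (polygonE _ pw mw m1) em /= mulr1 -natr1.
  rewrite [_ + 1]addrC addrK subrr mul0r add0r mul1r.
  have -> : m.+1 = (size w).-1 by rewrite em.
  by rewrite nth_last -(eqP tw); congr (_ == _)%:R; case: (w) sw.
Qed.

(** A word whose consecutive letters always lie in the carrier of [f] is a
    simplicial approximation of [f]. *)
Lemma approximation_homotopic (f : R -> realization R K) u N :
  is_loop base f -> (0 < N)%N -> size u = N.+1 ->
  (forall s j, I s -> (j < N)%N -> j%:R <= N%:R * s <= j.+1%:R ->
     support (f s) (nth b u j) /\ support (f s) (nth b u j.+1)) ->
  edge_loop K b u /\ homotopic base f (polygon u).
Proof.
move=> lf N0 su fu; have [_ f0 f1] := lf.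
have N0' : (N%:R : R) != 0 by rewrite pnatr_eq0 -lt0n.
have baseE v : support base v -> v = b.
  by rewrite /support /= pnatr_eq0 eqb0 negbK => /eqP.
have lu : edge_loop K b u.
  apply/and4P; split.
  - by rewrite su ltnS.
  - rewrite -nth0; apply/eqP/baseE; rewrite -f0.
    apply: (proj1 (fu 0 0%N _ _ _)) => //; first by rewrite /= in_itv /= lexx ler01.
    by rewrite mulr0 lexx /=.
  - rewrite (last_nth b) su; apply/eqP/baseE; rewrite -f1.
    have -> : nth b (b :: u) N.+1 = nth b u N.-1.+1 by rewrite prednK.
    apply: (proj2 (fu 1 N.-1 _ _ _)); rewrite ?prednK//.
      by rewrite /= in_itv /= lexx ler01.
    by rewrite mulr1 lexx ler_nat leq_pred.
  - case: u su fu => // x u [su] fu /=; apply/(pathP b) => j ju.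
    have [|||fx fy] := fu (j%:R / N%:R) j.
    + rewrite /= in_itv /= divr_ge0//= ler_pdivrMr ?ltr0n// mul1r ler_nat.
      by rewrite -su ltnW.
    + by rewrite -su.
    + by rewrite mulrC divfK// lexx ler_nat leqnSn.
    exact: simplex_edge (support_simplex _) fx fy.
split=> //; apply: line_homotopic => //; first exact: polygon_loop.
move=> s Is; exists (support (f s)); first exact: support_simplex.
split=> // v; have [j ju js] := polygon_piece lu Is.
have [_ _ _ pu] := and4P lu.
rewrite su /= in ju js *; have [fj fj1] := fu s j Is ju js.
have := @support_polygon u j s pu; rewrite su => /(_ ju js v).
by move=> /[apply] -[] ->.
Qed.

(** The letter at time [i / N] is a vertex whose open star contains the image of
    both neighbouring grid intervals. *)
Lemma loop_polygon (f : R -> realization R K) : is_loop base f ->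
  exists2 w, edge_loop K b w & homotopic base f (polygon w).
Proof.
move=> lf; have [cf _ _] := lf.
have [e e0 he] := star_lebesgue_number (@segment_compact R 0 1) cf.
have /choice[vv hv] : forall z, exists v, I z -> forall y, I y -> ball z e y ->
    support (f y) v.
  move=> z; have [/he[v hv]|nz] := pselect (I z); first by exists v.
  by exists b.
have [N N0 Ne] := natinv_lt e0.
pose u := mkseq (fun i => vv (i%:R / N%:R)) N.+1.
have [||||lu fu] := @approximation_homotopic f u N => //.
- by rewrite size_mkseq.
- move=> s j Is jN /andP[js sj].
  have NR : 0 < N%:R :> R by rewrite ltr0n.
  have near i : (i <= N)%N -> `|N%:R * s - i%:R| <= 1 -> support (f s) (nth b u i).
    move=> iN si; rewrite nth_mkseq//; apply: hv => //.
      rewrite /= in_itv /= divr_ge0//= ler_pdivrMr// mul1r ler_nat.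
      by rewrite -ltnS.
    apply: le_lt_trans Ne; rewrite -[leRHS]mul1r ler_pdivlMr//.
    rewrite -[X in _ * X](gtr0_norm NR) -normrM mulrBl divfK ?gt_eqF//.
    by rewrite distrC mulrC.
  rewrite -natr1 in sj; split; apply: near => //; first exact: ltnW.
    by rewrite ger0_norm; lra.
  by rewrite -natr1 ler0_norm; lra.
- by exists u.
Qed.

End polygons.

(** * Homotopy of polygons is homotopy of edge paths *)

Section polygon_homotopy.
Context {R : realType} {V : choiceType} {K : simplicial_complex V}.
Context {b : V} (Kb : K [set b]).
Implicit Types (v : V) (w u : seq V) (s t : R).
Local Notation I := (`[0 : R, 1]%classic).
Local Notation square := (`[0 : R, 1]%classic `*` `[0 : R, 1]%classic).
Local Notation base := (vertex R Kb).
Local Notation polygon := (polygon Kb).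

(** Simplicial approximation of a homotopy [H] on a square grid. The four vertices
    chosen at the corners of a small square lie in the carrier of the image of its
    lower left corner, so each row of the grid is parallel to the next one. The
    left and right sides of the square are mapped to the base point, which makes
    each row a loop. *)
Lemma homotopic_polygon w w' : edge_loop K b w -> edge_loop K b w' ->
  homotopic base (polygon w) (polygon w') -> edge_equiv K w w'.
Proof.
move=> lw lw' [H [cH Hs Ht]].
have baseE v : support base v -> v = b.
  by rewrite /support /= pnatr_eq0 eqb0 negbK => /eqP.
have [e e0 he] := star_lebesgue_number
  (compact_setX (@segment_compact R 0 1) (@segment_compact R 0 1)) cH.
have /choice[vv hv] : forall z, exists v, square z -> forall y, square y ->
    ball z e y -> support (H y) v.
  move=> z; have [/he[v hv]|nz] := pselect (square z); first by exists v.
  by exists b.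
have [N N0 Ne] := natinv_lt e0.
have w0 := edge_loop_size lw; have w0' := edge_loop_size lw'.
have [m mE] : exists m, m = (size w).-1 by eexists.
have [m' mE'] : exists m, m = (size w').-1 by eexists.
rewrite -mE in w0; rewrite -mE' in w0'.
(* The number of columns is a multiple of the numbers of edges of both words, so
   that the polygons pass through their vertices at grid points. *)
have [n nE] : exists n, n = (m * (m' * N))%N by eexists.
have n0 : (0 < n)%N by rewrite nE !muln_gt0 w0 w0'.
have n0R : 0 < n%:R :> R by rewrite ltr0n.
pose q i : R := i%:R / n%:R.
have Iq i : (i <= n)%N -> I (q i).
  by move=> iN; rewrite /= in_itv /= divr_ge0//= ler_pdivrMr// mul1r ler_nat.
have ne : n%:R^-1 < e.
  apply: le_lt_trans Ne; rewrite lef_pV2 ?posrE ?ltr0n// ler_nat.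
  by rewrite nE mulnA leq_pmull// muln_gt0 w0.
have qn i j : (i <= j <= i.+1)%N -> ball (q j) e (q i) /\ ball (q i) e (q j).
  move=> /andP[ij ji]; suff: `|q j - q i| < e by split=> //; exact: ball_sym.
  apply: le_lt_trans ne; rewrite -mulrBl -natrB// ger0_norm ?divr_ge0//.
  by rewrite -[leRHS]mul1r ler_pM2r ?invr_gt0// lern1 leq_subLR addn1.
pose row j := mkseq (fun i => vv (q i, q j)) n.+1.
have rowE i j : (i <= n)%N -> nth b (row j) i = vv (q i, q j).
  by move=> iN; rewrite nth_mkseq.
have carrier i j i' j' : (i' <= n)%N -> (j' <= n)%N -> (i <= n)%N -> (j <= n)%N ->
    ball (q i') e (q i) -> ball (q j') e (q j) ->
    support (H (q i, q j)) (nth b (row j') i').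
  by move=> *; rewrite rowE//; apply: hv; split=> //; exact: Iq.
have q0 : q 0%N = 0 by rewrite /q mul0r.
have q1 : q n = 1 by rewrite /q divff// gt_eqF.
have qq i : ball (q i) e (q i) by exact: ballxx.
have row_loop j : (j <= n)%N -> edge_loop K b (row j).
  move=> jn; apply/and4P; split.
  - by rewrite size_mkseq ltnS.
  - rewrite -nth0; apply/eqP/baseE; rewrite -(Ht _ (Iq _ jn)).1 -q0.
    exact: carrier.
  - rewrite (last_nth b) size_mkseq; apply/eqP/baseE.
    rewrite -(Ht _ (Iq _ jn)).2 -q1 [nth _ _ _]/=.
    exact: carrier.
  - have -> : sorted (edge K) (row j) = path (edge K) (nth b (row j) 0) (behead (row j)) by [].
    apply/(pathP b) => i; rewrite size_behead size_mkseq /= => iN.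
    have := support_simplex (H (q i, q j)); move/simplex_edge; apply.
      have -> : nth b (nth b (row j) 0 :: behead (row j)) i = nth b (row j) i by [].
      by apply: carrier => //; exact: ltnW.
    have -> : nth b (behead (row j)) i = nth b (row j) i.+1 by [].
    apply: carrier => //; first exact: ltnW.
    by have [] := qn i i.+1 (introT andP (conj (leqnSn i) (leqnn _))).
have row_step j : (j < n)%N -> edge_equiv K (row j) (row j.+1).
  move=> jn; apply: (@edge_equiv_parallel _ _ b).
  - exact/row_loop/ltnW.
  - exact/row_loop.
  - by rewrite !size_mkseq.
  - rewrite size_mkseq => i; rewrite ltnS => iN.
    have Kij := support_simplex (H (q i, q j)).
    have [iq _] := qn i i.+1 (introT andP (conj (leqnSn i) (leqnn _))).
    have [jq _] := qn j j.+1 (introT andP (conj (leqnSn j) (leqnn _))).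
    by split; apply: (simplex3 Kij); apply: carrier => //; exact: ltnW.
have rows j : (j <= n)%N -> edge_equiv K (row 0%N) (row j).
  elim: j => [_|j IH jn]; first exact: edge_refl.
  exact: edge_trans (IH (ltnW jn)) (row_step _ jn).
(* The first and the last row approximate the polygons themselves. *)
have ends u j k : edge_loop K b u -> n = ((size u).-1 * k)%N -> (0 < k)%N ->
    (j <= n)%N -> (forall s, I s -> H (s, q j) = polygon u s) ->
    edge_equiv K (row j) u.
  move=> lu nk k0 jn Hj; have u0 := edge_loop_size lu.
  apply: (@edge_equiv_refine _ _ b k (size u).-1) => //.
  - exact: row_loop.
  - by case: (u) u0.
  - by rewrite size_mkseq nk.
  - move=> i l lu' /andP[li il].
    have iN : (i <= n)%N by rewrite nk (leq_trans il)// leq_pmul2r.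
    have [_ _ _ pu] := and4P lu.
    have := @carrier i j i j iN jn iN jn (qq i) (qq j); rewrite Hj; last exact: Iq.
    move=> /(@support_polygon _ _ _ _ Kb u l); case=> //.
    + by case: (size u) lu'.
    + have qE : (size u).-1%:R * q i = i%:R / k%:R.
        by rewrite /q nk natrM invfM mulrCA mulVKf// pnatr_eq0 -lt0n.
      by rewrite qE ler_pdivlMr ?ltr0n// ler_pdivrMr ?ltr0n// -!natrM !ler_nat li.
    + by left.
    + by right.
apply: (edge_trans (edge_sym (ends w 0%N (m' * N)%N lw _ _ _ _))) => //.
- by rewrite -mE.
- by rewrite muln_gt0 w0'.
- by move=> s /Hs[]; rewrite q0.
apply: edge_trans (rows n (leqnn n)) _.
apply: (ends w' n (m * N)%N) => //.
- by rewrite -mE' nE mulnCA.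
- by rewrite muln_gt0 w0.
- by move=> s /Hs[]; rewrite q1.
Qed.

(** The two sides [x -> y -> z] are traversed while the other polygon runs along
    [x -> z] at half speed. *)
Lemma triangle_homotopic w x y z u : K [set x; y; z] ->
  edge_loop K b (w ++ [:: x, y, z & u]) ->
  homotopic base (polygon (w ++ [:: x, y, z & u])) (polygon (w ++ [:: x, z & u])).
Proof.
move=> Kxyz lxyz; set a := (w ++ _) in lxyz *; set c := w ++ _.
have lxz : edge_loop K b c.
  by rewrite -(edge_equiv_loop _ (edge_triangle w u Kxyz)).
have [m m0 sc] : exists2 m, (0 < m)%N & size c = m.+1.
  by exists (size w + (size u).+1)%N; rewrite ?addnS// size_cat /= !addnS.
have sa : size a = m.+2 by rewrite size_cat /= addnS -sc size_cat.
have m0R : 0 < m%:R :> R by rewrite ltr0n.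
pose i := size w.
have im : (i < m)%N.
  by move: sc; rewrite size_cat /= !addnS => -[<-]; rewrite ltnS leq_addr.
(* Time on the second polygon, which has one edge less: [tau] runs at half speed
   while [t] goes from [i] to [i + 2], and lags by one afterwards. *)
pose tau t := t - Num.min 2 (Num.max 0 (t - i%:R)) / 2.
pose phi s : R := tau (m.+1%:R * s) / m%:R.
have imR : i%:R + 1 <= m%:R :> R by rewrite natr1 ler_nat.
have tauI t : 0 <= t <= m.+1%:R -> 0 <= tau t <= m%:R.
  rewrite -natr1 => /andP[t0 tm]; have i0 : 0 <= i%:R :> R by [].
  by rewrite /tau minElt maxElt; apply/andP; split; repeat case: ifPn; rewrite -?leNgt; lra.
have phi0 : phi 0 = 0.
  by rewrite /phi /tau mulr0 !sub0r max_l ?oppr_le0// min_r// mul0r oppr0 mul0r.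
have phi1 : phi 1 = 1.
  rewrite /phi /tau mulr1 -natr1 max_r; last by lra.
  by rewrite min_l ?divff//; [rewrite addrK divff// gt_eqF|lra].
have phiI s : I s -> I (phi s).
  rewrite /= !in_itv /= => /andP[s0 s1].
  have /tauI/andP[t0 t1] : 0 <= m.+1%:R * s <= m.+1%:R.
    by rewrite mulr_ge0//= ler_piMr.
  by rewrite divr_ge0//= ler_pdivrMr// mul1r.
have cphi : continuous phi.
  move=> s; apply: cvgM; last exact: cvg_cst.
  have ct : (m.+1%:R * r : R) @[r --> s] --> m.+1%:R * s.
    by apply: cvgM; [exact: cvg_cst|exact: cvg_id].
  apply: cvgB => //; apply: cvgM; last exact: cvg_cst.
  apply: (@continuous_min R R (fun=> 2) (fun s => Num.max 0 (m.+1%:R * s - i%:R))).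
    exact: cvg_cst.
  apply: (@continuous_max R R (fun=> 0) (fun s => m.+1%:R * s - i%:R)).
    exact: cvg_cst.
  by apply: cvgB => //; exact: cvg_cst.
have [cc c0 c1] := @polygon_loop R _ _ _ Kb _ lxz.
have lphi : is_loop base (polygon c \o phi).
  split; rewrite /= ?phi0 ?phi1//.
  apply: (@within_comp _ _ _ I I phi) => //.
  exact: continuous_subspaceT.
have : homotopic base (polygon c \o phi) (polygon c \o id).
  apply: reparametrization => //; rewrite ?phi0 ?phi1//.
  by move=> s; exact: cvg_id.
move=> H; apply: homotopic_trans _ H.
apply: line_homotopic => //; first exact: polygon_loop.
move=> s Is; have [_ _ _ pa] := and4P lxyz; have [_ _ _ pc] := and4P lxz.
have [j ja js] := polygon_piece lxyz Is.
have Sa := support_polygon (Kb := Kb) pa ja js.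
have Sc l : (l < m)%N -> l%:R <= tau (m.+1%:R * s) <= l.+1%:R ->
    support (polygon c (phi s)) `<=` [set nth b c l; nth b c l.+1].
  move=> lm ls; apply: support_polygon => //; rewrite sc//=.
  by rewrite /phi mulrC divfK// gt_eqF.
rewrite sa /= in js ja; set t := m.+1%:R * s in js Sc *.
have ea k : nth b a k = if (k < i)%N then nth b w k else nth b [:: x, y, z & u] (k - i)%N.
  by rewrite nth_cat.
have ec k : nth b c k = if (k < i)%N then nth b w k else nth b [:: x, z & u] (k - i)%N.
  by rewrite nth_cat.
rewrite -natr1 in js; move/andP: js => [jt tj].
have edge_c l : (l < m)%N -> K [set nth b c l; nth b c l.+1].
  move=> lm; apply/asboolP; have : (l.+1 < size c)%N by rewrite sc.
  case: (c) pc => // d c' /(pathP b) pc'; exact: pc'.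
(* Before the triangle, on its sides, and behind it. *)
have [ji|ij] := ltnP j i.
  have jiR : j%:R + 1 <= i%:R :> R by rewrite natr1 ler_nat.
  have jm : (j < m)%N by exact: ltn_trans im.
  exists [set nth b c j; nth b c j.+1]; first exact: edge_c.
  split; last first.
    apply: Sc => //; rewrite /tau -[j.+1%:R]natr1 max_l ?min_r//; last by lra.
    by rewrite ?mul0r ?subr0; apply/andP; split; lra.
  have <- : nth b a j = nth b c j by rewrite ea ec ji.
  have <- // : nth b a j.+1 = nth b c j.+1.
  rewrite ea ec; case: ltnP => // ij; have -> : (j.+1 - i = 0)%N by apply/eqP.
  by [].
have ijR : i%:R <= j%:R :> R by rewrite ler_nat.
have [ji2|i2j] := ltnP j i.+2.
  exists [set x; y; z]; first by [].
  have ji2R : j%:R <= i%:R + 1 :> R by rewrite natr1 ler_nat.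
  split.
    apply: subset_trans Sa _.
    have [->|->] : j = i \/ j = i.+1 by move: ij ji2; lia.
      rewrite !ea ltnn subnn ltnNge leqnSn subSnn /= => v [->|->].
        by left; left.
      by left; right.
    rewrite !ea ltnNge leqnSn subSnn ltnNge (leq_trans (leqnSn i) (leqnSn _)) /=.
    rewrite -[i.+2]addn2 addKn /= => v [->|->].
      by left; right.
    by right.
  apply: subset_trans (Sc i im _) _.
    rewrite /tau -[i.+1%:R]natr1 minElt maxElt; apply/andP.
    by split; repeat case: ifPn; rewrite -?leNgt; lra.
  rewrite !ec ltnn subnn ltnNge leqnSn subSnn /= => v [->|->].
    by left; left.
  by right.
case: j ja jt tj ij i2j ijR Sa => // j ja jt tj ij i2j ijR Sa.
have ijR' : i%:R + 1 <= j%:R :> R by rewrite natr1 ler_nat.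
rewrite -natr1 in jt tj.
have jm : (j < m)%N by [].
exists [set nth b c j; nth b c j.+1]; first exact: edge_c.
split; last first.
  apply: Sc => //; rewrite /tau max_r; last by lra.
  by rewrite min_l ?divff// -?[j.+1%:R]natr1; [apply/andP; split; lra|lra].
have e k : (i < k)%N -> nth b a k.+1 = nth b c k.
  move=> ik; have ik' := ltnW ik.
  rewrite ea ec ltnNge (leq_trans ik' (leqnSn k)) ltnNge ik' /= subSn//.
  by move: ik; rewrite -subn_gt0; case: (k - i)%N.
by rewrite -!e//; exact: ltnW.
Qed.

Lemma equiv_polygon_homotopic w w' : edge_loop K b w -> edge_equiv K w w' ->
  homotopic base (polygon w) (polygon w').
Proof.
move=> + ww'; elim: ww' => {w w'}
  [w lw|w w' ww' IH lw'|w w' w'' ww' IH ww'' IH' lw|w x y z u Kxyz lw].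
- exact/homotopic_refl/polygon_loop.
- by apply/homotopic_sym/IH; rewrite (edge_equiv_loop _ ww').
- apply: homotopic_trans (IH lw) (IH' _).
  by rewrite -(edge_equiv_loop _ ww').
- exact: triangle_homotopic.
Qed.

End polygon_homotopy.

(** * Inclusions on the fundamental group *)

Section edge_path_group.
Context {V : choiceType} (K L : simplicial_complex V) (b : V).

Definition edge_surjective := forall w, edge_loop L b w ->
  exists2 w', edge_loop K b w' & edge_equiv L w w'.

Definition edge_injective := forall w w', edge_loop K b w -> edge_loop K b w' ->
  edge_equiv L w w' -> edge_equiv K w w'.

End edge_path_group.

Lemma surjective_bijective (T U : Type) (f : T -> U) :
  injective f -> (forall u, exists t, f t = u) -> bijective f.
Proof.
move=> finj /choice[g fg]; exists g => [t|u]; last exact: fg.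
by apply: finj; rewrite fg.
Qed.

Section pi1_inclusion.
Context {R : realType} {V : choiceType} {K L : simplicial_complex V}.
Context (KL : subcomplex K L) (b : V) (Kb : K [set b]) (Lb : L [set b]).
Local Notation I := (`[0 : R, 1]%classic).
Local Notation incl := (@realization_incl R _ _ _ KL).
Local Notation incl_map := (@pi1_map R _ _ _ (@realization_incl_continuous R _ _ _ KL)
  _ _ (realization_incl_vertex R KL Kb Lb)).

Lemma edge_loop_sub w : edge_loop K b w -> edge_loop L b w.
Proof.
move=> /and4P[sw hw tw pw]; apply/and4P; split=> //.
by apply: sub_sorted pw => x y /asboolP /KL Lxy; apply/asboolP.
Qed.

Lemma incl_polygon w : edge_loop K b w ->
  homotopic (vertex R Lb) (incl \o polygon Kb w) (polygon Lb w).
Proof.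
move=> lw; have lw' := edge_loop_sub lw.
have [_ _ _ pw] := and4P lw; have [_ _ _ pw'] := and4P lw'.
apply: line_homotopic.
- exact: (comp_loop (@realization_incl_continuous R _ _ _ KL)
    (realization_incl_vertex R KL Kb Lb) (polygon_loop Kb lw)).
- exact: polygon_loop.
- move=> s Is; exists (support (polygon Lb w s)); first exact: support_simplex.
  split=> // v; rewrite /support /=.
  by have [j jw js] := polygon_piece lw Is; rewrite !(polygonE _ _ _ jw js).
Qed.

Let incl_loop (f : R -> realization R K) :
  is_loop (vertex R Kb) f -> is_loop (vertex R Lb) (incl \o f).
Proof.
exact: (comp_loop (@realization_incl_continuous R _ _ _ KL)
  (realization_incl_vertex R KL Kb Lb)).
Qed.

Let incl_map_class (f : loop R (vertex R Kb)) :
  incl_map (loop_class f) = loop_class (Loop (incl_loop (loopP f))).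
Proof.
apply/loop_class_eq => /=.
exact: (homotopic_comp (@realization_incl_continuous R _ _ _ KL)
  (realization_incl_vertex R KL Kb Lb) (repr_loop_class f)).
Qed.

Let pi1_class (T : topologicalType) (x : T) (a : pi1 R x) :
  exists f : loop R x, a = loop_class f.
Proof. by exists (repr a); rewrite /loop_class reprK. Qed.

(** Loops are polygons up to homotopy, and polygons are homotopic exactly when
    their words are equivalent; both facts are natural in the complex. *)
Lemma pi1_inclusion_bijective : bijective incl_map <->
  edge_surjective K L b /\ edge_injective K L b.
Proof.
split=> [[g gK Kg]|[surj inj]].
  have map_inj := can_inj gK.
  split=> [w lw|w w' lw lw' Lww'].
    have [f gf] := pi1_class (g (loop_class (Loop (polygon_loop Lb lw)))).
    have [w' lw' fw'] := loop_polygon (loopP f).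
    exists w' => //; apply: (@homotopic_polygon _ _ _ _ Lb) => //.
      exact: edge_loop_sub.
    apply: homotopic_trans (incl_polygon lw').
    have /loop_class_eq/= : incl_map (loop_class f) =
        loop_class (Loop (polygon_loop Lb lw)) by rewrite -gf Kg.
    move=> fw; apply: homotopic_trans (homotopic_sym fw) _.
    apply: homotopic_trans (homotopic_comp (@realization_incl_continuous R _ _ _ KL)
      (realization_incl_vertex R KL Kb Lb) (repr_loop_class f)) _.
    exact: (homotopic_comp (@realization_incl_continuous R _ _ _ KL)
      (realization_incl_vertex R KL Kb Lb) fw').
  apply: (@homotopic_polygon R _ _ _ Kb) => //.
  have /loop_class_eq // : loop_class (Loop (@polygon_loop R _ _ _ Kb _ lw)) =
    loop_class (Loop (polygon_loop Kb lw')).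
  apply: map_inj; rewrite !incl_map_class; apply/loop_class_eq => /=.
  apply: homotopic_trans (incl_polygon lw) _.
  apply: homotopic_trans (homotopic_sym (incl_polygon lw')).
  by apply: equiv_polygon_homotopic => //; exact: edge_loop_sub.
apply: surjective_bijective => [a a'|a].
  have [f ->] := pi1_class a; have [f' ->] := pi1_class a'.
  have [w lw fw] := loop_polygon (loopP f).
  have [w' lw' fw'] := loop_polygon (loopP f').
  rewrite !incl_map_class => /loop_class_eq/= ff'; apply/loop_class_eq.
  apply: homotopic_trans (fw) _; apply: homotopic_trans (homotopic_sym fw').
  apply: equiv_polygon_homotopic => //; apply: inj => //.
  apply: (@homotopic_polygon R _ _ _ Lb); rewrite ?edge_loop_sub//.
  apply: homotopic_trans (homotopic_sym (incl_polygon lw)) _.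
  apply: homotopic_trans (incl_polygon lw').
  have hc g g' := @homotopic_comp R _ _ _ (@realization_incl_continuous R _ _ _ KL)
    _ _ (realization_incl_vertex R KL Kb Lb) g g'.
  apply: homotopic_trans (homotopic_sym (hc _ _ fw)) _.
  exact: homotopic_trans ff' (hc _ _ fw').
have [f ->] := pi1_class a; have [w lw fw] := loop_polygon (loopP f).
have [w' lw' ww'] := surj w lw.
exists (loop_class (Loop (@polygon_loop R _ _ _ Kb _ lw'))).
rewrite incl_map_class; apply/loop_class_eq => /=.
apply: homotopic_trans (incl_polygon lw') _.
apply: homotopic_trans (homotopic_sym fw).
by apply/homotopic_sym; exact: equiv_polygon_homotopic.
Qed.

End pi1_inclusion.

(** * Rips complexes of geodesic spaces *)

Lemma finite_has_max (R : realType) (E : set R) : finite_set E -> E !=set0 ->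
  exists2 m, E m & ubound E m.
Proof.
move=> /finite_seqP[l ->] [x xl]; have {x xl}l0 : l != [::] by case: (l) xl.
elim: l l0 => // x [|y l] IH _.
  by exists x; rewrite /= ?mem_head// => z; rewrite /= inE => /eqP ->.
have [//|m ml lm] := IH _; have [xm|/ltW mx] := leP x m.
  exists m; first by rewrite /= inE ml orbT.
  by move=> z; rewrite /= inE => /predU1P[->//|]; exact: lm.
exists x; first by rewrite /= mem_head.
move=> z; rewrite /= inE => /predU1P[->//|/lm zm].
exact: le_trans zm mx.
Qed.

Section rips_words.
Context {R : realType} {X : metricType R}.
Implicit Types (A S : set X) (p q : R) (x y z : X).

Lemma diameter_ltP (s : set X) p : finite_set s -> s !=set0 ->
  diameter s < p <-> forall x y, s x -> s y -> mdist x y < p.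
Proof.
move=> fs [x0 sx0]; rewrite /diameter; set E := [set _ | _ in _].
have [||m Em mE] := @finite_has_max R E.
- by apply: finite_image; exact: finite_setX.
- by exists (mdist x0 x0), (x0, x0).
have -> : sup E = m.
  apply/eqP; rewrite eq_le; apply/andP; split.
    by apply: ge_sup => //; exists m.
  by apply: ub_le_sup => //; exists m.
split=> [mp x y sx sy|sp]; last by case: Em => -[x y] [/= sx sy] <-; exact: sp.
by apply: le_lt_trans mp; apply: mE; exists (x, y).
Qed.

Lemma rips3 A p x y z : A x -> A y -> A z ->
  mdist x y < p -> mdist x z < p -> mdist y z < p -> rips A p [set x; y; z].
Proof.
move=> Ax Ay Az xy xz yz.
have p0 : 0 < p by apply: le_lt_trans xy; exact: mdist_ge0.
have fin : finite_set [set x; y; z].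
  apply: (@sub_finite_set _ _ [set` [:: x; y; z]]); last exact: finite_seq.
  by move=> _ /= [[->|->]|->]; rewrite !inE eqxx ?orbT.
have neq0 : [set x; y; z] !=set0 by exists x; left; left.
split=> //; first by move=> _ [[->|->]|->].
apply/diameter_ltP => // _ _ [[->|->]|->] [[->|->]|->];
  by rewrite ?mdistxx// metric_sym.
Qed.

Lemma edge_ripsP A p x y :
  reflect [/\ A x, A y & mdist x y < p] (edge (rips A p) x y).
Proof.
apply: (iffP idP) => [/asboolP[fs s0 sA sp]|[Ax Ay xy]].
  split; [by apply: sA; left|by apply: sA; right|].
  by apply: (diameter_ltP p fs s0).1 => //; [left|right].
have p0 : 0 < p by apply: le_lt_trans xy; exact: mdist_ge0.
apply: (@simplex_edge _ (rips A p) [set x; x; y]); [|by left; left|by right].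
by apply: rips3 => //; rewrite mdistxx.
Qed.

(** The cone over a path from its starting point. *)
Lemma rips_cone A q x y w : A x ->
  (forall z, z \in y :: w -> A z /\ mdist x z < q) ->
  path (fun a c => mdist a c < q) y w ->
  edge_equiv (rips A q) [:: x, y & w] [:: x; last y w].
Proof.
move=> Ax yw yw_path; apply: edge_equiv_cone.
elim: w y yw yw_path => //= z w IH y yw /andP[yz zw]; apply/andP; split.
  apply/asboolP.
  have [Ay xy] : A y /\ mdist x y < q by apply: yw; rewrite !inE eqxx.
  have [Az xz] : A z /\ mdist x z < q by apply: yw; rewrite !inE eqxx orbT.
  exact: rips3.
by apply: IH => // z' z'w; apply: yw; rewrite inE z'w orbT.
Qed.

Lemma rips_cocone A q x y w : A y ->
  (forall z, z \in x :: w -> A z /\ mdist z y < q) ->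
  path (fun a c => mdist a c < q) x w ->
  edge_equiv (rips A q) ((x :: w) ++ [:: y]) [:: x; y].
Proof.
move=> Ay xw xw_path; apply: edge_equiv_cocone.
elim: w x xw xw_path => //= z w IH x xw /andP[xz zw]; apply/andP; split.
  apply/asboolP.
  have [Ax xy] : A x /\ mdist x y < q by apply: xw; rewrite !inE eqxx.
  have [Az zy] : A z /\ mdist z y < q by apply: xw; rewrite !inE eqxx orbT.
  exact: rips3.
by apply: IH => // z' z'w; apply: xw; rewrite inE z'w orbT.
Qed.

Lemma within_mdist (Z : topologicalType) (B : set Z) (f : Z -> X) x :
  {within B, continuous f} -> {within B, continuous (fun u => mdist x (f u))}.
Proof.
move=> cf; apply: (@within_continuous_comp _ _ _ B f (mdist x)) => // y _.
apply/cvgrPdist_lt => e e0; apply/nbhs_ballP; exists e => //= z.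
rewrite ballEmdist /= => yz.
have := metric_triangle x y z; have := metric_triangle x z y.
rewrite (metric_sym z y) => xyz xzy.
by rewrite ltr_distlC; apply/andP; split; lra.
Qed.

(** By the intermediate value theorem a geodesic from [x] contains a point at half
    the distance; the partition of [0, 1] at this point bounds its distance to
    [y]. *)
Lemma geodesic_midpoint x y : geodesic X ->
  exists m, mdist x m <= mdist x y / 2 /\ mdist m y <= mdist x y / 2.
Proof.
move=> /(_ x y)[f [cf f0 f1 lf]].
have D0 : 0 <= mdist x y := mdist_ge0 x y.
have [|c + fc] := @IVT R (fun t => mdist x (f t)) 0 1 (mdist x y / 2) ler01
    (@within_mdist _ _ _ x cf).
  by rewrite f0 f1 mdistxx min_l// max_r//; apply/andP; split; lra.
rewrite in_itv /= => /andP[c0 c1].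
have [D00|Dn0] := eqVneq (mdist x y) 0.
  by exists x; rewrite mdistxx D00 mul0r.
have {}c0 : 0 < c.
  rewrite lt_neqAle c0 andbT; apply: contra Dn0 => /eqP c0'.
  by move: fc; rewrite -c0' f0 mdistxx => fc; apply/eqP; lra.
have {}c1 : c < 1.
  rewrite lt_neqAle c1 andbT; apply: contra Dn0 => /eqP c1'.
  by move: fc; rewrite c1' f1 => fc; apply/eqP; lra.
exists (f c); split; first by rewrite fc.
have : (((mdist x (f c) + mdist (f c) y)%:E) <= (mdist x y)%:E)%E.
  rewrite -lf; apply: ereal_sup_ubound; exists [:: c; 1].
    by split=> //=; rewrite c0 c1.
  by rewrite !big_ord_recl big_ord0 /= addr0 f0 f1.
by rewrite lee_fin fc => ?; lra.
Qed.

(** Repeated bisection; the chain keeps within the distance of [x] and [y] from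
    both of them, as needed for coning it off. *)
Lemma geodesic_chain e x y : geodesic X -> 0 < e ->
  exists u, [/\ (0 < size u)%N, path (fun a c => mdist a c < e) x u,
    last x u = y & forall z, z \in x :: u ->
      mdist x z <= mdist x y /\ mdist z y <= mdist x y].
Proof.
move=> geoX e0.
have [k] : exists k, mdist x y < 2 ^+ k * e.
  exists (Num.trunc (mdist x y / e)).+1; rewrite -ltr_pdivrMr//.
  apply: lt_le_trans (truncnS_gt _) _; rewrite -natrX ler_nat.
  exact/ltnW/ltn_expl.
elim: k x y => [|k IH] x y xy.
  exists [:: y]; split=> //=; first by rewrite andbT -[e]mul1r.
  by move=> z; rewrite !inE => /orP[]/eqP->; rewrite mdistxx mdist_ge0.
have [m [xm my]] := geodesic_midpoint x y geoX.
rewrite exprS in xy.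
have [|u [u0 xu um uD]] := IH x m; first by lra.
have [|u' [u0' mu uy uD']] := IH m y; first by lra.
exists (u ++ u'); split.
- by rewrite size_cat addn_gt0 u0.
- by rewrite cat_path xu um.
- by rewrite last_cat um.
- have D0 : 0 <= mdist x y := mdist_ge0 x y.
  move=> z; rewrite -cat_cons mem_cat => /orP[/uD[xz zm]|zu].
    by have := metric_triangle z m y; split; lra.
  have [|mz zy] := uD' z; first by rewrite inE zu orbT.
  by have := metric_triangle x m z; split; lra.
Qed.

Lemma sub_step_path p q w x : p <= q -> path (fun a c => mdist a c < p) x w ->
  path (fun a c => mdist a c < q) x w.
Proof. by move=> pq; apply: sub_path => a c /lt_le_trans; exact. Qed.

Lemma rips_path p w x :
  path (fun a c => mdist a c < p) x w -> path (edge (rips [set: X] p)) x w.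
Proof. by apply: sub_path => a c ac; apply/edge_ripsP. Qed.

Lemma rips_edge_subdivision p q x y : geodesic X -> 0 < p -> p <= q ->
  mdist x y < q -> exists u, [/\ (0 < size u)%N,
    path (fun a c => mdist a c < p) x u, last x u = y &
    edge_equiv (rips [set: X] q) (x :: u) [:: x; y]].
Proof.
move=> geoX p0 pq xy; have [u [u0 xu uy uD]] := geodesic_chain x y geoX p0.
exists u; split=> //; case: u u0 xu uy uD => // z u _ /andP[_ zu] uy uD; rewrite -uy.
apply: rips_cone => //; last first.
  exact: sub_step_path pq zu.
move=> z' z'u; split=> //; have [|xz' _] := uD z'; first by rewrite inE z'u orbT.
exact: le_lt_trans xz' xy.
Qed.

End rips_words.

(** * Scales without critical values *)

Section persistence.
Context {R : realType}.
Implicit Types (p q r c s : R).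

Lemma critical_threshold_gt0 (iso : R -> R -> Prop) r c :
  critical_threshold iso r c -> 0 < c.
Proof. by case=> [[[]]|[_ /andP[]]]. Qed.

(** [inj p q] expresses that nothing from scale [p] is lost at scale [q]:
    [valid p] are the elements, or the pairs of elements, at scale [p], and [null q]
    those that vanish, or become equal, at scale [q]. Let [s] be the supremum of
    the scales [q <= r] with [inj p q]. As vanishing is an open condition on the
    scale, [inj p s] holds. If [s < r], then [s] is not right critical, so
    [inj s (s + e)] for some [e > 0], and [s] could be increased. *)
Lemma threshold_injective (iso : R -> R -> Prop) (T : Type)
    (valid null : R -> T -> Prop) r c :
  let inj p q := forall t, valid p t -> null q t -> null p t in
  (forall p q, iso p q -> inj p q) ->
  (forall p q t, p <= q -> valid p t -> valid q t) ->
  (forall p q t, p <= q -> null p t -> null q t) ->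
  (forall q t, null q t -> exists2 p, p < q & null p t) ->
  critical_threshold iso r c -> forall p, c < p -> p < r -> inj p r.
Proof.
move=> inj iso_inj valid_mono null_mono null_open crit p cp pr.
have c0 := critical_threshold_gt0 crit.
have regular s : c < s -> s < r -> ~ critical_value iso s.
  move=> cs sr; case: crit => [[_ _ max_c] /max_c/(_ sr)|[no_crit _] crit_s].
    by rewrite leNgt cs.
  by apply: no_crit; exists s.
pose A := [set q | p <= q <= r /\ inj p q].
have Ap : A p by split=> [|t //]; rewrite lexx ltW.
have supA : has_sup A by split; [exists p|exists r => q [/andP[]]].
have ps : p <= sup A by apply: ub_le_sup => //; exact: supA.2.
have sr : sup A <= r by apply: ge_sup => [|q [/andP[]]]//; exists p.
have inj_s : inj p (sup A).
  move: ps; rewrite le_eqVlt => /predU1P[<- //|ps] t vt /null_open[q qs nq].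
  have [a [_ inj_a] qa] : exists2 a, A a & q < a.
    have [a Aa] := @sup_adherent _ A (sup A - q) (eqbRL (subr_gt0 _ _) qs) supA.
    by rewrite subKr; exists a.
  by apply: inj_a => //; apply: null_mono nq; exact: ltW.
move: (sr); rewrite le_eqVlt => /predU1P[<- //|sr'].
have s0 : c < sup A by exact: lt_le_trans ps.
have [e e0 iso_e] : exists2 e, 0 < e & iso (sup A) (sup A + e).
  have := regular _ s0 sr'; rewrite /critical_value /right_critical.
  move=> /not_andP[/(_ (lt_trans c0 s0))//|/not_orP[_ /existsNP[e /not_implyP[e0 /contrapT]]]].
  by exists e.
pose s' := Num.min (sup A + e) r.
have ss' : sup A < s' by rewrite lt_min sr' andbT ltrDl.
suff : A s' by move=> /(ub_le_sup supA.2); rewrite leNgt ss'.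
split; first by rewrite ge_min lexx orbT andbT ltW// (le_lt_trans ps).
move=> t vt nt; apply: inj_s => //.
apply: (iso_inj _ _ iso_e).
- exact: valid_mono vt.
- by apply: null_mono nt; rewrite ge_min lexx.
Qed.

End persistence.

(** * Subdivision of edge paths *)

Section subdivision.
Context {V : choiceType}.

(** [E] is any congruence on words; it is used for the conjunction of two
    homotopies, of a word and of its image under a map. *)
Lemma walk_subdivision (K L : simplicial_complex V) (E : seq V -> seq V -> Prop) :
  (forall w, E w w) -> (forall w w' w'', E w w' -> E w' w'' -> E w w'') ->
  (forall a w w' u, E w w' -> E (a ++ w ++ u) (a ++ w' ++ u)) ->
  (forall x y, edge L x y -> exists u, [/\ (0 < size u)%N, path (edge K) x u,
     last x u = y & E (x :: u) [:: x; y]]) ->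
  forall x w, path (edge L) x w -> exists u, [/\ (size w <= size u)%N,
    path (edge K) x u, last x u = last x w & E (x :: u) (x :: w)].
Proof.
move=> Er Et Ec sub x w; elim: w x => [|y w IH] x /=; first by exists [::].
move=> /andP[/sub[u [u0 xu uy Eu]] /IH[u' [wu' yu' u'w Eu']]].
exists (u ++ u'); split.
- by rewrite size_cat -add1n leq_add.
- by rewrite cat_path xu uy.
- by rewrite last_cat uy.
- apply: Et (Ec [::] _ _ u' Eu) _ => /=.
  by have := Ec [:: x] _ _ [::] Eu'; rewrite !cats0.
Qed.

Lemma loop_subdivision (K L : simplicial_complex V) (b : V)
    (E : seq V -> seq V -> Prop) :
  (forall w, E w w) -> (forall w w' w'', E w w' -> E w' w'' -> E w w'') ->
  (forall a w w' u, E w w' -> E (a ++ w ++ u) (a ++ w' ++ u)) ->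
  (forall x y, edge L x y -> exists u, [/\ (0 < size u)%N, path (edge K) x u,
     last x u = y & E (x :: u) [:: x; y]]) ->
  forall w, edge_loop L b w -> exists2 u, edge_loop K b u & E u w.
Proof.
move=> Er Et Ec sub [|x w] /and4P[] // sw hw tw pw.
have [u [wu xu uw Eu]] := walk_subdivision Er Et Ec sub pw.
exists (x :: u) => //; apply/and4P; split=> //; last by rewrite /= uw.
exact: leq_trans sw _.
Qed.

End subdivision.

Section rips_pi1.
Context {R : realType} {X : metricType R} (geoX : geodesic X).
Implicit Types (A S : set X) (p q r : R) (x y z : X).

Lemma rips_edge_surjective p q b : 0 < p -> p <= q ->
  edge_surjective (rips [set: X] p) (rips [set: X] q) b.
Proof.
move=> p0 pq w lw.
have [||||u lu uw] := @loop_subdivision _ (rips setT p) (rips setT q) b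
    (edge_equiv (rips setT q)) _ _ _ _ w lw.
- exact: edge_refl.
- by move=> w1 w2 w3; exact: edge_trans.
- exact: edge_equiv_cat.
- move=> x y /edge_ripsP[_ _ xy].
  have [u [u0 xu uy uxy]] := rips_edge_subdivision geoX p0 pq xy.
  by exists u; split=> //; exact: rips_path.
by exists u => //; exact: edge_sym.
Qed.

(** A homotopy of edge paths uses finitely many triangles, whose diameters are
    strictly smaller than the scale. *)
Lemma rips_equiv_open A q w w' : edge_equiv (rips A q) w w' ->
  exists2 p, p < q & edge_equiv (rips A p) w w'.
Proof.
have mono p p' u u' : p <= p' -> edge_equiv (rips A p) u u' ->
    edge_equiv (rips A p') u u'.
  by move=> pp'; apply: edge_equiv_sub; exact: rips_sub.
elim=> {w w'} [w|w w' _ [p pq ww']|w w' w'' _ [p pq ww'] _ [p' pq' ww'']|w x y z u].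
- by exists (q - 1); [rewrite ltrBlDr ltrDl|exact: edge_refl].
- by exists p => //; exact: edge_sym.
- exists (Num.max p p'); first by rewrite gt_max pq.
  apply: edge_trans (mono _ _ _ _ _ ww') (mono _ _ _ _ _ ww'');
    by rewrite le_max lexx ?orbT.
- move=> [fs s0 sA sq]; exists ((diameter [set x; y; z] + q) / 2); first lra.
  by apply: edge_triangle; split=> //; lra.
Qed.

Lemma pi1_bonding_iso_injective b p q : pi1_bonding_iso b p q ->
  edge_injective (rips [set: X] p) (rips [set: X] q) b.
Proof. by move=> [p0 [q0 [pq /pi1_inclusion_bijective[]]]]. Qed.

End rips_pi1.

(** * Moving points into a sample *)

Section sampling.
Context {R : realType} {X : metricType R} (geoX : geodesic X).
Context (S : set X) (p r e : R) (f : X -> X).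
Hypotheses (p0 : 0 < p) (e0 : 0 < e) (pr : p + 2 * e <= r).
Hypotheses (fS : forall x, S (f x)) (fe : forall x, mdist x (f x) < e)
  (fK : forall x, S x -> f x = x).
Implicit Types (x y z : X).

Lemma sample_mdist x y : mdist (f x) (f y) < mdist x y + 2 * e.
Proof.
have := metric_triangle (f x) x (f y); have := metric_triangle x y (f y).
have := fe x; have := fe y; rewrite (metric_sym (f x) x) => *; lra.
Qed.

Lemma sample_triangle x y z : rips [set: X] p [set x; y; z] ->
  rips S r [set f x; f y; f z].
Proof.
move=> Kxyz; have close a c : [set x; y; z] a -> [set x; y; z] c ->
    mdist (f a) (f c) < r.
  move=> sa sc; have /edge_ripsP[_ _ ac] := simplex_edge Kxyz sa sc.
  by apply: lt_le_trans (sample_mdist a c) (le_trans _ pr); rewrite lerD2r ltW.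
by apply: rips3 => //; apply: close; do ?[by left; left|by left; right|by right].
Qed.

(** Both halves of the edge are subdivided; after [f] is applied, the first half
    lies within [r / 2 + e] of [x] and the second one within [r / 2 + e] of [y],
    which is less than [r] because [2 * e <= r - p]. *)
Lemma sample_edge x y : S x -> S y -> mdist x y < r -> exists u,
  [/\ (0 < size u)%N, path (edge (rips [set: X] p)) x u, last x u = y,
    edge_equiv (rips [set: X] r) (x :: u) [:: x; y] &
    edge_equiv (rips S r) (map f (x :: u)) [:: x; y]].
Proof.
move=> Sx Sy xy; have [m [xm my]] := geodesic_midpoint x y geoX.
have D0 : 0 <= mdist x y := mdist_ge0 x y.
have [u [u0 xu um uD]] := geodesic_chain x m geoX p0.
have [u' [u0' mu' uy uD']] := geodesic_chain m y geoX p0.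
move: (p0) (e0) (pr) => p_gt0 e_gt0 pe_r.
have step a c : mdist a c < p -> mdist (f a) (f c) < r.
  by have := sample_mdist a c => ? ?; lra.
have xfm : mdist x (f m) < r.
  by have := metric_triangle x m (f m); have := fe m => *; lra.
have fmy : mdist (f m) y < r.
  by have := metric_triangle (f m) m y; have := fe m; rewrite (metric_sym m (f m)) => *; lra.
have rpos : p <= r by lra.
case: u u0 xu um uD => // a u _ /= /andP[xa au] um uD.
case: u' u0' mu' uy uD' => // c u' _ /= /andP[mc cu'] uy uD'.
have Exm : edge_equiv (rips setT r) [:: x, a & u] [:: x; m].
  rewrite -[X in [:: _; X]]um; apply: rips_cone => // [z za|].
    have [|xz _] := uD z; first by rewrite inE za orbT.
    by split=> //; lra.
  by apply: sub_path au => ? ? /lt_le_trans; exact.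
have Emy : edge_equiv (rips setT r) [:: m, c & u'] [:: m; y].
  rewrite -[X in [:: _; X]]uy; apply: rips_cone => // [z zc|].
    have [|mz _] := uD' z; first by rewrite inE zc orbT.
    by split=> //; lra.
  by apply: sub_path cu' => ? ? /lt_le_trans; exact.
have fExm : edge_equiv (rips S r) [:: x, f a & map f u] [:: x; f m].
  rewrite -[X in [:: _; f X]]um -last_map; apply: rips_cone => // [z|].
    rewrite -map_cons => /mapP[z' za ->]; split=> //.
    have [|xz _] := uD z'; first by rewrite inE za orbT.
    by have := metric_triangle x z' (f z'); have := fe z' => *; lra.
  by rewrite path_map; apply: sub_path au => ? ? /step.
have fEmy : edge_equiv (rips S r) [:: f m, f c & map f u'] [:: f m; y].
  have : last c u' = y by [].
  case/lastP: u' {Emy} cu' uy uD' => [_ _ uD' /= ->|u' z cu' uy uD'].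
    by rewrite (fK Sy); exact: edge_refl.
  rewrite last_rcons => zy; rewrite map_rcons zy (fK Sy) -cats1 -!cat_cons.
  apply: rips_cocone => // [z'|].
    rewrite -!map_cons => /mapP[d du ->]; split=> //.
    have [|_ dy] := uD' d.
      by rewrite -rcons_cons -rcons_cons mem_rcons inE du orbT.
    by have := metric_triangle (f d) d y; have := fe d; rewrite (metric_sym d (f d)) => *; lra.
  move: cu'; rewrite rcons_path => /andP[cu' _].
  by rewrite /= step//= path_map; apply: sub_path cu' => ? ? /step.
exists ((a :: u) ++ c :: u'); split=> //.
- by apply: rips_path; rewrite /= cat_path xa au um /= mc.
- by rewrite /= last_cat.
- apply: edge_trans (edge_equiv_catr (c :: u') Exm) _.
  apply: edge_trans (edge_equiv_cons x Emy) _.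
  by apply: (edge_triangle [::] [::]); apply: rips3 => //; lra.
- rewrite map_cons map_cat /= (fK Sx).
  apply: edge_trans (edge_equiv_catr (f c :: map f u') fExm) _.
  apply: edge_trans (edge_equiv_cons x fEmy) _.
  by apply: (edge_triangle [::] [::]); apply: rips3.
Qed.

(** The inclusion and [f] are contiguous. *)
Lemma sample_loop b w : S b -> edge_loop (rips [set: X] p) b w ->
  edge_loop (rips S r) b (map f w) /\ edge_equiv (rips [set: X] r) w (map f w).
Proof.
move=> Sb lw; move: (p0) (e0) (pr) => p_gt0 e_gt0 pe_r.
have [sw hw tw pw] := and4P lw.
have lfw : edge_loop (rips S r) b (map f w).
  apply/and4P; rewrite size_map; split=> //.
  - by case: (w) hw => //= x _ /eqP->; rewrite fK.
  - by case: (w) sw tw => //= x v _ /eqP xb; rewrite last_map xb fK.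
  - rewrite sorted_map; apply: sub_sorted pw => x y /edge_ripsP[_ _ xy].
    by apply/edge_ripsP; split=> //; have := sample_mdist x y => *; lra.
split=> //.
have lw' : edge_loop (rips [set: X] r) b w.
  by apply: edge_loop_sub lw; apply: rips_sub => //; lra.
have lfw' : edge_loop (rips [set: X] r) b (map f w).
  by apply: edge_loop_sub lfw; exact: rips_sub.
apply: (edge_equiv_parallel lw' lfw') => [|i iw]; first by rewrite size_map.
rewrite !(nth_map b)//; last exact: ltnW.
set x := nth b w i; set y := nth b w i.+1.
have /edge_ripsP[_ _ xy] : edge (rips [set: X] p) x y.
  by case: (w) iw @x @y pw => // a v iw x y /(pathP b)/(_ i iw).
have := fe x; have := fe y => fy fx.
have xfy : mdist x (f y) < r by have := metric_triangle x y (f y) => ?; lra.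
have fxy : mdist (f x) (f y) < r by have := sample_mdist x y => ?; lra.
by split; apply: rips3 => //; lra.
Qed.

Lemma sample_fixed_loop b w : edge_loop (rips S r) b w -> map f w = w.
Proof.
case: w => [|x [|y w]] /and4P[] //= _ _ _ /andP[/edge_ripsP[Sx Sy _] yw].
rewrite !fK//; congr [:: _, _ & _].
elim: w y Sy yw => //= z w IH y Sy /andP[/edge_ripsP[_ Sz _] zw].
by rewrite fK// (IH z).
Qed.

Lemma sample_loop_subdivision b w : edge_loop (rips S r) b w ->
  exists2 u, edge_loop (rips [set: X] p) b u &
    edge_equiv (rips [set: X] r) u w /\ edge_equiv (rips S r) (map f u) w.
Proof.
move=> lw.
pose E u v := edge_equiv (rips [set: X] r) u v /\
  edge_equiv (rips S r) (map f u) (map f v).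
have [||||u lu [uw fuw]] := @loop_subdivision _ (rips [set: X] p) (rips S r) b E _ _ _ _ w lw.
- by move=> v; split; exact: edge_refl.
- by move=> u v v' [uv fuv] [vv' fvv']; split; [exact: edge_trans vv'|exact: edge_trans fvv'].
- move=> a u v v' [uv fuv]; rewrite /E !map_cat.
  by split; exact: edge_equiv_cat.
- move=> x y /edge_ripsP[Sx Sy xy].
  have [u [u0 xu uy Eu fEu]] := sample_edge Sx Sy xy.
  by exists u; split=> //; split=> //; rewrite [map f [:: x; y]]/= (fK Sx) (fK Sy).
by exists u => //; rewrite (sample_fixed_loop lw) in fuw.
Qed.

End sampling.

Section sample_existence.
Context {R : realType} {X : metricType R}.
Implicit Types (S : set X) (c d e p r : R).

(** Each point has a sample point at distance less than [d], with room to spare in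
    a neighbourhood; finitely many neighbourhoods cover [X]. *)
Lemma dense_within_shrink S d : compact [set: X] -> dense_within d S ->
  exists2 e, 0 < e & dense_within (d - e) S.
Proof.
move=> /compact_near_coveringP cX dS.
have [|e /= e0 he] := cX R (0 : R)^'+ (fun e x => exists2 y, S y & mdist x y < d - e).
  move=> x _; have [y Sy xy] := dS x.
  have a0 : 0 < (d - mdist x y) / 2 by rewrite divr_gt0// subr_gt0.
  exists (ball x ((d - mdist x y) / 2), [set e | e < (d - mdist x y) / 2]) => /=.
    by split; [exact: nbhsx_ballx|exact: nbhs_right_lt].
  move=> [x' e] /= []; rewrite ballEmdist /= => xx' ed; exists y => //.
  by have := metric_triangle x' x y; rewrite (metric_sym x' x) => ?; lra.
exists (e / 2); first by rewrite divr_gt0.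
move=> x; apply: (he (e / 2)) => //; last by rewrite divr_gt0.
by rewrite /= sub0r normrN gtr0_norm ?divr_gt0// ltr_pdivrMr// ltr_pMr// ltr1n.
Qed.

Lemma nearest_sample S e : dense_within e S ->
  exists f : X -> X, [/\ forall x, S (f x), forall x, mdist x (f x) < e &
    forall x, S x -> f x = x].
Proof.
move=> eS; have /choice[f hf] : forall x, exists y,
    [/\ S y, mdist x y < e & S x -> y = x].
  move=> x; have [y Sy xy] := eS x.
  have [Sx|nSx] := pselect (S x); last by exists y.
  by exists x; rewrite mdistxx; split=> //; apply: le_lt_trans xy; exact: mdist_ge0.
by exists f; split=> x; have [] := hf x.
Qed.

(** Compactness leaves some room between the scale [p] of the sampled paths and
    the threshold [c]. *)
Lemma sample_scale S c r (b : X) : compact [set: X] -> dense_within ((r - c) / 2) S ->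
  exists p e (f : X -> X), [/\ c < p, p < r, 0 < e & p + 2 * e <= r] /\
    [/\ forall x, S (f x), forall x, mdist x (f x) < e & forall x, S x -> f x = x].
Proof.
move=> cX /(dense_within_shrink cX)[a a0 /nearest_sample[f [fS fe fK]]].
have e0 : 0 < (r - c) / 2 - a by apply: le_lt_trans (fe b); exact: mdist_ge0.
by exists (c + 2 * a), ((r - c) / 2 - a), f; split=> //; split; lra.
Qed.

End sample_existence.

(** * Fundamental groups of samples *)

Section pi1_sampling.
Context {R : realType} {X : metricType R}.

Lemma pi1_sampling (b : X) (r : R) (r0 : 0 < r) (c : R) (S : set X) (Sb : S b) :
  compact [set: X] -> geodesic X ->
  critical_threshold (pi1_bonding_iso b) r c ->
  dense_within ((r - c) / 2) S -> bijective (mu_pi1 Sb r0).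
Proof.
move=> cX geoX crit /(sample_scale b cX)[p [e [f [[cp pr e0 per] [fS fe fK]]]]].
have p0 : 0 < p by exact: lt_trans (critical_threshold_gt0 crit) cp.
have inj : edge_injective (rips setT p) (rips setT r) b.
  have := @threshold_injective R (pi1_bonding_iso b) (seq X * seq X)
    (fun q w => edge_loop (rips setT q) b w.1 /\ edge_loop (rips setT q) b w.2)
    (fun q w => edge_equiv (rips setT q) w.1 w.2) r c.
  move=> /(_ _ _ _ _ crit p cp pr) inj w w' lw lw' ww'.
  apply: (inj _ _ _ _ (w, w')) => // {w w' lw lw' ww' inj}.
  - move=> q s iso [w w'] /= [lw lw'].
    exact: (pi1_bonding_iso_injective iso).
  - move=> q s [w w'] qs /= [lw lw'].
    by split; [apply: edge_loop_sub lw|apply: edge_loop_sub lw']; exact: rips_sub.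
  - by move=> q s [w w'] qs /=; apply: edge_equiv_sub; exact: rips_sub.
  - by move=> q [w w']; exact: rips_equiv_open.
apply/pi1_inclusion_bijective; split=> [w lw|w w' lw lw' ww'].
  have [u lu wu] := rips_edge_surjective geoX p0 (ltW pr) lw.
  have [lfu ufu] := sample_loop p0 e0 per fS fe fK Sb lu.
  by exists (map f u) => //; exact: edge_trans wu ufu.
have [u lu [uw fuw]] := sample_loop_subdivision geoX p0 e0 per fS fe fK lw.
have [u' lu' [uw' fuw']] := sample_loop_subdivision geoX p0 e0 per fS fe fK lw'.
have uu' : edge_equiv (rips setT p) u u'.
  by apply: inj => //; apply: edge_trans uw (edge_trans ww' (edge_sym uw')).
apply: edge_trans (edge_sym fuw) (edge_trans _ fuw').
by apply: edge_equiv_map uu' => x y z; exact: (sample_triangle per fS fe).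
Qed.

End pi1_sampling.

(** * Chains and null-homologous functions *)

Section finite_sums.
Context {G : zmodType}.

Lemma sum_setT (V : choiceType) (T : seq V) (f : V -> G) : uniq T ->
  (forall v, v \notin T -> f v = 0) ->
  \sum_(v \in [set: V]) f v = \sum_(v <- T) f v.
Proof.
move=> uT fT; rewrite (fsbigE T)//; last by move=> v _; exact: fT.
by apply: eq_bigl => v; rewrite in_setT.
Qed.

Lemma sum_indicator (V : eqType) (T : seq V) (P : pred V) x (g : G) :
  uniq T -> x \in T -> \sum_(v <- T) g *+ ((v == x) && P v) = g *+ P x.
Proof.
move=> uT xT; rewrite (bigD1_seq x)//= eqxx big1 ?addr0// => v /negbTE ->.
by [].
Qed.

Lemma sum_alternating (V : Type) (T : seq V) (P : pred V) (h : V -> V -> G) :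
  (forall x y, h y x = - h x y) -> (forall x, h x x = 0) ->
  \sum_(x <- T | P x) \sum_(y <- T | P y) h x y = 0.
Proof.
move=> hN h0; rewrite -[LHS]big_filter.
under eq_bigr do rewrite -big_filter.
elim: {T P}[seq x <- T | P x] => [|x T IH]; first by rewrite big_nil.
rewrite big_cons big_cons h0 add0r.
under [X in _ + X]eq_bigr do rewrite big_cons hN.
by rewrite big_split /= sumrN IH addr0 subrr.
Qed.

End finite_sums.

Section chains.
Context {V : choiceType} {G : zmodType}.
Implicit Types (K L : simplicial_complex V) (x y z u v : V) (g : G) (w : seq V).
Implicit Types (c : V * V -> G) (d : V * V * V -> G) (T : seq V).

Lemma finite_vertices1 c : finite_set [set p | c p != 0] ->
  exists2 T, uniq T & forall x y, c (x, y) != 0 -> x \in T /\ y \in T.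
Proof.
move=> /finite_seqP[s cs].
exists (undup (map fst s ++ map snd s)); first exact: undup_uniq.
move=> x y cxy; rewrite !mem_undup !mem_cat.
have xys : (x, y) \in s by have : [set p | c p != 0] (x, y) := cxy; rewrite cs.
by rewrite (map_f fst xys) (map_f snd xys) orbT.
Qed.

Lemma finite_vertices2 d : finite_set [set p | d p != 0] ->
  exists2 T, uniq T & forall x y z, d (x, y, z) != 0 ->
    [/\ x \in T, y \in T & z \in T].
Proof.
move=> /finite_seqP[s ds].
pose p1 (p : V * V * V) := p.1.1; pose p2 (p : V * V * V) := p.1.2.
exists (undup (map p1 s ++ map p2 s ++ map snd s)); first exact: undup_uniq.
move=> x y z dxyz; rewrite !mem_undup !mem_cat.
have xyzs : (x, y, z) \in s.
  by have : [set p | d p != 0] (x, y, z) := dxyz; rewrite ds.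
by rewrite (map_f p1 xyzs) (map_f p2 xyzs) (map_f snd xyzs) !orbT.
Qed.

Lemma finite_support1 T c : (forall x y, c (x, y) != 0 -> x \in T /\ y \in T) ->
  finite_set [set p | c p != 0].
Proof.
move=> cT; apply: (@sub_finite_set _ _ ([set` T] `*` [set` T])).
  by move=> [x y] /= /cT[].
by apply: finite_setX; exact: finite_seq.
Qed.

Lemma finite_support2 T d :
  (forall x y z, d (x, y, z) != 0 -> [/\ x \in T, y \in T & z \in T]) ->
  finite_set [set p | d p != 0].
Proof.
move=> dT; apply: (@sub_finite_set _ _ ([set` T] `*` [set` T] `*` [set` T])).
  by move=> [[x y] z] /= /dT[].
by do 2! (apply: finite_setX; last exact: finite_seq); exact: finite_seq.
Qed.

Lemma boundary1E T c x : uniq T ->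
  (forall u v, c (u, v) != 0 -> u \in T /\ v \in T) ->
  boundary1 c x = \sum_(u <- T) c (u, x).
Proof.
move=> uT cT; apply: sum_setT => // u uT'; apply/eqP/negP => /negP/cT[].
by rewrite (negbTE uT').
Qed.

Lemma boundary2E T d p : uniq T ->
  (forall x y z, d (x, y, z) != 0 -> [/\ x \in T, y \in T & z \in T]) ->
  boundary2 d p = \sum_(u <- T) d (u, p.1, p.2).
Proof.
move=> uT dT; apply: sum_setT => // u uT'; apply/eqP/negP => /negP/dT[].
by rewrite (negbTE uT').
Qed.

(** The elementary chain g [x, y]; as a function of [g] it is additive. *)
Definition edge_chain x y g : V * V -> G :=
  fun p => g *+ (p == (x, y)) - g *+ (p == (y, x)).

Let edge_chain_is_additive x y : zmod_morphism (edge_chain x y).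
Proof.
move=> g g'; apply/funext => p; rewrite /edge_chain !fctE !mulrnBl.
by rewrite !opprD !opprK addrACA.
Qed.

HB.instance Definition _ x y := GRing.isZmodMorphism.Build G (V * V -> G)
  (edge_chain x y) (edge_chain_is_additive x y).

Lemma edge_chain_sym x y g : edge_chain y x g = - edge_chain x y g.
Proof. by apply/funext => p; rewrite /edge_chain !fctE opprB. Qed.

Lemma edge_chain_chain1 K x y g : edge K x y -> chain1 K (edge_chain x y g).
Proof.
move=> /asboolP Kxy.
have cT u v : edge_chain x y g (u, v) != 0 -> [set x; y] u /\ [set x; y] v.
  rewrite /edge_chain; have [[-> ->] _|_] := eqVneq (u, v) (x, y).
    by split; [left|right].
  have [[-> ->] _|_] := eqVneq (u, v) (y, x); first by split; [right|left].
  by rewrite subrr eqxx.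
split.
- apply: (@finite_support1 [:: x; y]) => u v /cT[ux vx].
  by split; rewrite !inE; [case: ux => ->|case: vx => ->]; rewrite eqxx ?orbT.
- by move=> u v /cT[ux vx]; apply: simplex2 Kxy ux vx.
- by move=> u v; rewrite /edge_chain opprB !xpair_eqE andbC [(v == y) && _]andbC.
- by move=> u; rewrite /edge_chain !xpair_eqE andbC subrr.
Qed.

Lemma chain1D K c c' : chain1 K c -> chain1 K c' -> chain1 K (c + c').
Proof.
move=> [fc Kc ac dc] [fc' Kc' ac' dc'].
have nz p : (c + c') p != 0 -> c p != 0 \/ c' p != 0.
  rewrite fctE; have [->|_ _] := eqVneq (c p) 0; last by left.
  by rewrite add0r; right.
split.
- apply: (@sub_finite_set _ _ ([set p | c p != 0] `|` [set p | c' p != 0])).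
    by move=> p /nz.
  by rewrite finite_setU.
- by move=> x y /nz[/Kc|/Kc'].
- by move=> x y; rewrite !fctE ac ac' opprD.
- by move=> x; rewrite !fctE dc dc' addr0.
Qed.

Lemma chain1_0 K : chain1 K (0 : V * V -> G).
Proof.
split=> [|x y|x y|x]; rewrite ?fctE ?oppr0 ?eqxx//.
by apply: (@finite_support1 [::]) => x y; rewrite eqxx.
Qed.

Lemma chain1_sum K (I : eqType) (l : seq I) (F : I -> V * V -> G) :
  (forall i, i \in l -> chain1 K (F i)) -> chain1 K (\sum_(i <- l) F i).
Proof.
move=> KF; rewrite big_seq; elim/big_ind: _ => //; first exact: chain1_0.
by move=> *; exact: chain1D.
Qed.

Lemma boundary1B c c' x : finite_set [set p | c p != 0] ->
  finite_set [set p | c' p != 0] ->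
  boundary1 (c - c') x = boundary1 c x - boundary1 c' x.
Proof.
move=> /finite_vertices1[T uT cT] /finite_vertices1[T' uT' cT'].
pose U := undup (T ++ T').
have uU : uniq U := undup_uniq _.
have cU u v : c (u, v) != 0 -> u \in U /\ v \in U.
  by move=> /cT[]; rewrite !mem_undup !mem_cat => -> ->.
have cU' u v : c' (u, v) != 0 -> u \in U /\ v \in U.
  by move=> /cT'[]; rewrite !mem_undup !mem_cat => -> ->; rewrite !orbT.
rewrite (boundary1E _ uU cU) (boundary1E _ uU cU') (boundary1E _ uU) ?sumrB//.
move=> u v; rewrite !fctE; have [->|/cU//] := eqVneq (c (u, v)) 0.
by rewrite sub0r oppr_eq0 => /cU'.
Qed.

(** Every alternating chain is a finite combination of oriented edges; the
    orientations are chosen one edge at a time. *)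
Lemma chain1_edges K c : chain1 K c ->
  exists2 l : seq (G * (V * V)), (forall t, t \in l -> edge K t.2.1 t.2.2) &
    c = \sum_(t <- l) edge_chain t.2.1 t.2.2 t.1.
Proof.
move=> Kc; have [fc _ _ _] := Kc; move: fc => /finite_seqP[s].
have [n sn] : exists n, (size s <= n)%N by exists (size s).
move=> cs; have {cs} : forall p, c p != 0 -> p \in s.
  by move=> p cp; have : [set p | c p != 0] p := cp; rewrite cs.
elim: n s sn c Kc => [|n IH] s sn c Kc cs.
  exists [::] => //; rewrite big_nil; apply/funext => p; apply/eqP/negP => /negP/cs.
  by move: sn; rewrite leqn0 size_eq0 => /eqP ->.
have [c0|] := pselect (c = 0); first by exists [::]; rewrite ?big_nil.
have [_ Kc2 ac dc] := Kc.
move=> c0; have [[x y] cxy] : exists p, c p != 0.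
  apply: contrapT => /forallNP c0'; apply: c0; apply/funext => p.
  by apply/eqP/negP => /negP/c0'.
have xy : x != y by apply: contra_neq cxy => ->.
have Exy : edge K x y by apply/asboolP; exact: Kc2.
have [|||l lE cl] := IH (rem (x, y) s) _ (c + edge_chain x y (- c (x, y))).
- by rewrite size_rem ?cs//; case: (s) sn.
- by apply: chain1D => //; exact: edge_chain_chain1.
- move=> [u v]; rewrite fctE /edge_chain; have [->|pxy] := eqVneq (u, v) (x, y).
    by rewrite xpair_eqE (negbTE xy) subr0 subrr eqxx.
  have [->|pyx] := eqVneq (u, v) (y, x).
    by rewrite sub0r opprK ac addNr eqxx.
  by rewrite subrr addr0 => /cs; exact: rem_mem.
exists ((c (x, y), (x, y)) :: l).
  by move=> t; rewrite inE => /predU1P[->//|]; exact: lE.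
by rewrite big_cons -cl /= raddfN addrC subrK.
Qed.

(** The boundaries, as a predicate on functions rather than on cycles of one
    complex: the same function is compared at several scales. *)
Definition null_homologous K c :=
  exists2 d, chain2 K d & forall p, boundary2 d p = c p.

Lemma null_homologous0 K : null_homologous K 0.
Proof.
exists (fun=> 0) => [|p]; last by rewrite (@boundary2E [::])// ?big_nil// => x y z /eqP.
split=> [|x y z|x y z|//]; [|by rewrite eqxx|by rewrite oppr0].
by apply: (@finite_support2 [::] (fun=> 0)) => x y z; rewrite eqxx.
Qed.

Lemma null_homologousB K c c' :
  null_homologous K c -> null_homologous K c' -> null_homologous K (c - c').
Proof.
move=> [d [fd Kd ad dd] dc] [d' [fd' Kd' ad' dd'] dc'].
have [T uT dT] := finite_vertices2 fd; have [T' uT' dT'] := finite_vertices2 fd'.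
pose U := undup (T ++ T').
have uU : uniq U := undup_uniq _.
have dU x y z : d (x, y, z) != 0 -> [/\ x \in U, y \in U & z \in U].
  by move=> /dT[]; rewrite !mem_undup !mem_cat => -> -> ->.
have dU' x y z : d' (x, y, z) != 0 -> [/\ x \in U, y \in U & z \in U].
  by move=> /dT'[]; rewrite !mem_undup !mem_cat => -> -> ->; rewrite !orbT.
have nz p : (d - d') p != 0 -> d p != 0 \/ d' p != 0.
  rewrite !fctE; have [->|_ _] := eqVneq (d p) 0; last by left.
  by rewrite sub0r oppr_eq0; right.
have ddU x y z : (d - d') (x, y, z) != 0 -> [/\ x \in U, y \in U & z \in U].
  by move=> /nz[/dU|/dU'].
exists (d - d'); last first.
  move=> p; rewrite (boundary2E _ uU ddU) !fctE -dc -dc'.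
  by rewrite (boundary2E _ uU dU) (boundary2E _ uU dU') sumrB.
split.
- exact: finite_support2 ddU.
- by move=> x y z /nz[/Kd|/Kd'].
- move=> x y z; have [e1 e2] := ad x y z; have [e1' e2'] := ad' x y z.
  by rewrite !fctE e1 e2 e1' e2' opprB opprK addrC.
- by move=> x y; rewrite !fctE dd dd' subrr.
Qed.

Lemma null_homologousN K c : null_homologous K c -> null_homologous K (- c).
Proof. by move=> /(null_homologousB (null_homologous0 K)); rewrite sub0r. Qed.

Lemma null_homologousD K c c' :
  null_homologous K c -> null_homologous K c' -> null_homologous K (c + c').
Proof. by move=> Kc /null_homologousN/(null_homologousB Kc); rewrite opprK. Qed.

Lemma null_homologous_sum K (I : eqType) (l : seq I) (F : I -> V * V -> G) :
  (forall i, i \in l -> null_homologous K (F i)) ->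
  null_homologous K (\sum_(i <- l) F i).
Proof.
move=> KF; rewrite big_seq; elim/big_ind: _ => //; first exact: null_homologous0.
by move=> *; exact: null_homologousD.
Qed.

Lemma null_homologous_sub K L c :
  subcomplex K L -> null_homologous K c -> null_homologous L c.
Proof. by move=> KL [d [fd Kd ad dd] dc]; exists d => //; split=> // x y z /Kd/KL. Qed.

(** The boundary of a boundary vanishes. *)
Lemma null_homologous_boundary1 K c x : null_homologous K c -> boundary1 c x = 0.
Proof.
move=> [d [fd Kd ad dd] dc]; have [T uT dT] := finite_vertices2 fd.
have cT v : v \notin T -> c (v, x) = 0.
  move=> vT; rewrite -dc (boundary2E _ uT dT) big1// => u _.
  by apply/eqP/negP => /negP/dT[_]; rewrite (negbTE vT).
rewrite /boundary1 (sum_setT uT cT).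
under eq_bigr do rewrite -dc (boundary2E _ uT dT).
by apply: (sum_alternating T predT) => [u v|u]; [exact: (ad _ _ _).1|exact: dd].
Qed.

Lemma null_homologous_triangle K x y z g : K [set x; y; z] ->
  null_homologous K (edge_chain x y g + edge_chain y z g - edge_chain x z g).
Proof.
(* The alternating function g [x, y, z]: the sum over the cyclic permutations of
   the arguments minus the sum over the other ones. *)
move=> Kxyz; pose t a b e := g *+ ((a == x) && ((b == y) && (e == z))).
pose cyc a b e := t a b e + t b e a + t e a b.
have cycC a b e : cyc b e a = cyc a b e by rewrite /cyc addrC addrA.
pose d (p : V * V * V) := cyc p.1.1 p.1.2 p.2 - cyc p.1.2 p.1.1 p.2.
have tT a b e : t a b e != 0 -> [/\ a = x, b = y & e = z].
  rewrite /t; have [/and3P[/eqP-> /eqP-> /eqP->]//|_] := boolP [&& _, _ & _].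
  by rewrite eqxx.
have cycT a b e : cyc a b e != 0 ->
    [/\ [set x; y; z] a, [set x; y; z] b & [set x; y; z] e].
  rewrite /cyc; have [->|/tT[-> -> ->] _] := eqVneq (t a b e) 0; last first.
    by split; [left; left|left; right|right].
  rewrite add0r; have [->|/tT[-> -> ->] _] := eqVneq (t b e a) 0; last first.
    by split; [right|left; left|left; right].
  by rewrite add0r => /tT[-> -> ->]; split; [left; right|right|left; left].
have dT a b e : d (a, b, e) != 0 ->
    [/\ [set x; y; z] a, [set x; y; z] b & [set x; y; z] e].
  rewrite /d /=; have [->|/cycT//] := eqVneq (cyc a b e) 0.
  by rewrite sub0r oppr_eq0 => /cycT[].
pose T := undup [:: x; y; z].
have uT : uniq T := undup_uniq _.
have [xT yT zT] : [/\ x \in T, y \in T & z \in T].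
  by rewrite !mem_undup !inE !eqxx !orbT.
have sT a : [set x; y; z] a -> a \in T by move=> [[->|->]|->].
have dT' a b e : d (a, b, e) != 0 -> [/\ a \in T, b \in T & e \in T].
  by move=> /dT[/sT ? /sT ? /sT].
exists d; first split.
- exact: finite_support2 dT'.
- by move=> a b e /dT[sa sb se]; exact: simplex3 Kxyz sa sb se.
- move=> a b e; rewrite /d /= opprB; split=> //.
  by rewrite (cycC b a e) (cycC b e a) (cycC a b e).
- by move=> a b; rewrite /d /= subrr.
move=> [b e]; rewrite (boundary2E _ uT dT') /d /cyc sumrB !big_split /=.
rewrite /t sum_indicator//.
rewrite (eq_bigr (fun v => g *+ ((v == z) && ((b == x) && (e == y))))); last first.
  by move=> v _; rewrite [RHS](congr1 (fun b : bool => g *+ b) (andbC _ _)) andbA.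
rewrite sum_indicator//.
rewrite (eq_bigr (fun v => g *+ ((v == y) && ((b == z) && (e == x))))); last first.
  by move=> v _; rewrite andbCA [(e == x) && _]andbC.
rewrite sum_indicator//.
rewrite (eq_bigr (fun v => g *+ ((v == y) && ((b == x) && (e == z))))); last first.
  by move=> v _; rewrite andbCA.
rewrite sum_indicator//.
rewrite (eq_bigr (fun v => g *+ ((v == x) && ((b == z) && (e == y))))); last first.
  by move=> v _; rewrite [(e == y) && _]andbC.
rewrite sum_indicator//.
rewrite (eq_bigr (fun v => g *+ ((v == z) && ((b == y) && (e == x))))); last first.
  by move=> v _; rewrite andbA andbC [(e == x) && _]andbC.
rewrite sum_indicator//.
rewrite /edge_chain !fctE !xpair_eqE !opprD !opprK.
by rewrite [LHS](AC (3*3) ((2*6)*(1*5)*(4*3))).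
Qed.

End chains.

(** * Words as chains *)

Section word_chains.
Context {V : choiceType} {G : zmodType}.
Implicit Types (K L : simplicial_complex V) (x y z u v : V) (g : G) (w : seq V).

Fixpoint walk_chain x w g : V * V -> G :=
  if w is y :: w' then edge_chain x y g + walk_chain y w' g else 0.

Definition word_chain w g := if w is x :: w' then walk_chain x w' g else 0.

Lemma word_chain_cat w x w' g : word_chain (w ++ x :: w') g =
  word_chain (rcons w x) g + word_chain (x :: w') g.
Proof.
case: w => [|y w] /=; first by rewrite add0r.
by elim: w y => [|z w IH] y /=; [rewrite addr0|rewrite IH addrA].
Qed.

Lemma word_chain_equiv K w w' g : edge_equiv K w w' ->
  null_homologous K (word_chain w g - word_chain w' g).
Proof.
elim=> {w w'} [w|w w' _|w w' w'' _ IH _ IH'|w x y z w' Kxyz].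
- by rewrite subrr; exact: null_homologous0.
- by move=> /null_homologousN; rewrite opprB.
- by have := null_homologousD IH IH'; rewrite subrKA.
- rewrite !word_chain_cat /= opprD addrACA subrr add0r addrA opprD addrA.
  rewrite addrAC addrK.
  exact: null_homologous_triangle.
Qed.

Lemma walk_chain_chain1 K x w g : path (edge K) x w -> chain1 K (walk_chain x w g).
Proof.
elim: w x => [|y w IH] x /=; first by move=> _; exact: chain1_0.
by move=> /andP[xy /IH]; apply: chain1D; exact: edge_chain_chain1.
Qed.

(** Sorted by vertices, the sum applies [h v] to minus the coefficient at [v] of
    the boundary of the cycle. *)
Lemma cycle_telescope (A : zmodType) (h : V -> {additive G -> A})
    (l : seq (G * (V * V))) :
  (forall v, boundary1 (\sum_(t <- l) edge_chain t.2.1 t.2.2 t.1) v = 0) ->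
  \sum_(t <- l) (h t.2.1 t.1 - h t.2.2 t.1) = 0.
Proof.
move=> bl.
pose T := undup (map (fun t => t.2.1) l ++ map (fun t => t.2.2) l).
have uT : uniq T := undup_uniq _.
have lT t : t \in l -> t.2.1 \in T /\ t.2.2 \in T.
  by move=> tl; rewrite !mem_undup !mem_cat !(map_f _ tl) orbT.
have edgeT t : t \in l -> forall u v, edge_chain t.2.1 t.2.2 t.1 (u, v) != 0 ->
    u \in T /\ v \in T.
  move=> /lT[xT yT] u v; rewrite /edge_chain.
  have [[-> ->] _|_] := eqVneq (u, v) (t.2.1, t.2.2); first by [].
  have [[-> ->] _|_] := eqVneq (u, v) (t.2.2, t.2.1); first by [].
  by rewrite subrr eqxx.
have pick x g : x \in T -> h x g = \sum_(v <- T) h v (g *+ (v == x)).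
  move=> xT; rewrite (bigD1_seq x)//= eqxx big1 ?addr0// => v /negbTE ->.
  by rewrite raddf0.
have -> : \sum_(t <- l) (h t.2.1 t.1 - h t.2.2 t.1) =
    \sum_(v <- T) h v (\sum_(t <- l) (t.1 *+ (v == t.2.1) - t.1 *+ (v == t.2.2))).
  under [RHS]eq_bigr do rewrite raddf_sum.
  rewrite exchange_big /=; apply: eq_big_seq => t /lT[xT yT].
  rewrite (pick _ _ xT) (pick _ _ yT) -sumrB.
  by apply: eq_bigr => v _; rewrite raddfB.
apply: big1_seq => v /andP[_ vT]; rewrite -[RHS](raddf0 (h v)); congr (h v _).
apply: oppr_inj; rewrite oppr0 -[RHS](bl v) (boundary1E _ uT); last first.
  move=> u v'; rewrite fct_sumE => sn0.
  have [t tl tn0] : exists2 t, t \in l & edge_chain t.2.1 t.2.2 t.1 (u, v') != 0.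
    apply: contrapT => H; move: sn0; rewrite big1_seq ?eqxx// => t /andP[_ tl].
    by apply/eqP/negP => /negP tn0; apply: H; exists t.
  exact: edgeT tn0.
under [RHS]eq_bigr do rewrite fct_sumE.
rewrite exchange_big /= -sumrN; apply: eq_big_seq => t /lT[xT yT].
rewrite /edge_chain sumrB opprB; congr (_ - _).
  under eq_bigr do rewrite xpair_eqE.
  by rewrite (sum_indicator (fun=> v == t.2.2)).
under eq_bigr do rewrite xpair_eqE.
by rewrite (sum_indicator (fun=> v == t.2.1)).
Qed.

(** * Images of chains under a vertex map *)

Section pushforward.
Context (f : V -> V) (T : seq V) (uT : uniq T).

(** The image under [f] of a chain supported on [T], which is a list so that the
    fibres of [f] become finite. *)
Definition push1 (c : V * V -> G) : V * V -> G := fun p =>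
  \sum_(x <- T | f x == p.1) \sum_(y <- T | f y == p.2) c (x, y).

Definition push2 (d : V * V * V -> G) : V * V * V -> G := fun p =>
  \sum_(x <- T | f x == p.1.1) \sum_(y <- T | f y == p.1.2)
    \sum_(z <- T | f z == p.2) d (x, y, z).

Let push1_is_additive : zmod_morphism push1.
Proof.
move=> c c'; apply/funext => p; rewrite /push1 !fctE -sumrB.
by apply: eq_bigr => x _; rewrite -sumrB.
Qed.

HB.instance Definition _ := GRing.isZmodMorphism.Build (V * V -> G) (V * V -> G)
  push1 push1_is_additive.

Lemma push1_edge x y g : x \in T -> y \in T ->
  push1 (edge_chain x y g) = edge_chain (f x) (f y) g.
Proof.
have pick z (P : pred V) (F : V -> G) : z \in T -> (forall v, v != z -> F v = 0) ->
    \sum_(v <- T | P v) F v = if P z then F z else 0.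
  move=> zT Fz; rewrite big_mkcond (bigD1_seq z)//= big1 ?addr0// => v vz.
  by case: ifP => // _; exact: Fz.
have push_indicator u v : u \in T -> v \in T -> forall p : V * V,
    \sum_(x <- T | f x == p.1) \sum_(y <- T | f y == p.2) g *+ ((x, y) == (u, v)) =
    g *+ (p == (f u, f v)).
  move=> uTT vT [a b] /=; rewrite (pick u)// => [|u' /negbTE uu'].
    rewrite (pick v)// => [|v' /negbTE vv']; last by rewrite xpair_eqE vv' andbF.
    rewrite eqxx xpair_eqE (eq_sym (f u)) (eq_sym (f v)).
    by case: (a == _); case: (b == _).
  by apply: big1 => v' _; rewrite xpair_eqE uu'.
move=> xT yT; apply/funext => p; rewrite /push1 /edge_chain.
under eq_bigr do rewrite sumrB.
by rewrite sumrB !push_indicator.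
Qed.

Lemma push1_walk x w g : x \in T -> {subset w <= T} ->
  push1 (walk_chain x w g) = walk_chain (f x) (map f w) g.
Proof.
elim: w x => [|y w IH] x xT wT /=; first by rewrite raddf0.
have yT : y \in T by apply: wT; rewrite mem_head.
rewrite raddfD /= push1_edge// IH// => z zw; apply: wT.
by rewrite inE zw orbT.
Qed.

Lemma push2_chain2 K L d :
  (forall x y z, K [set x; y; z] -> L [set f x; f y; f z]) ->
  chain2 K d -> chain2 L (push2 d).
Proof.
move=> KL [fd Kd ad dd].
have nz a b e : push2 d (a, b, e) != 0 -> exists x y z,
    [/\ d (x, y, z) != 0, x \in T /\ f x = a, y \in T /\ f y = b & z \in T /\ f z = e].
  move=> n0; apply: contrapT => H; move/eqP: n0; apply; rewrite /push2 /=.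
  apply: big1_seq => x /andP[/eqP xa xT]; apply: big1_seq => y /andP[/eqP yb yT].
  apply: big1_seq => z /andP[/eqP ze zT]; apply/eqP/negP => /negP dn0.
  by apply: H; exists x, y, z.
split.
- apply: (@finite_support2 _ _ (map f T)) => a b e.
  by move=> /nz[x [y [z [_ [xT <-] [yT <-] [zT <-]]]]]; rewrite !map_f.
- by move=> a b e /nz[x [y [z [/Kd/KL Lf [_ <-] [_ <-] [_ <-]]]]].
- move=> a b e; rewrite /push2 /=; split.
    rewrite exchange_big /= -sumrN; apply: eq_bigr => x _.
    rewrite -sumrN; apply: eq_bigr => y _.
    by rewrite -sumrN; apply: eq_bigr => z _; exact: (ad _ _ _).1.
  rewrite -sumrN; apply: eq_bigr => x _.
  rewrite exchange_big /= -sumrN; apply: eq_bigr => y _.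
  by rewrite -sumrN; apply: eq_bigr => z _; exact: (ad _ _ _).2.
- move=> a b; rewrite /push2 /=; apply: (sum_alternating T (fun x => f x == a)
      (h := fun x y => \sum_(z <- T | f z == b) d (x, y, z))) => [x y|x].
    by rewrite -sumrN; apply: eq_bigr => z _; exact: (ad _ _ _).1.
  by apply: big1 => z _; exact: dd.
Qed.

Lemma push_boundary d p :
  (forall x y z, d (x, y, z) != 0 -> [/\ x \in T, y \in T & z \in T]) ->
  boundary2 (push2 d) p = push1 (boundary2 d) p.
Proof.
move=> dT; case: p => b e.
rewrite /boundary2 (@sum_setT _ _ (undup (map f T)))//=; first last.
- move=> a; rewrite mem_undup => aT; apply: big1_seq => x /andP[/eqP xa xT].
  by move: xa => /= xa; rewrite -xa map_f in aT.
- exact: undup_uniq.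
rewrite /push1 /push2 /=.
rewrite [RHS](eq_bigr (fun y => \sum_(z <- T | f z == e) \sum_(x <- T) d (x, y, z))); last first.
  by move=> y _; apply: eq_bigr => z _; exact: (boundary2E (y, z) uT dT).
rewrite (exchange_big_dep predT)//=.
rewrite [LHS](eq_big_seq (fun x => \sum_(y <- T | f y == b)
    \sum_(z <- T | f z == e) d (x, y, z))); last first.
  move=> x xT; rewrite big_mkcond (bigD1_seq (f x)) ?undup_uniq ?mem_undup ?map_f//=.
  by rewrite eqxx [X in _ + X]big1 ?addr0// => a /negbTE; rewrite eq_sym => ->.
rewrite exchange_big /=; apply: eq_bigr => y _.
by rewrite exchange_big.
Qed.

End pushforward.

(** [T] has to contain the vertices of a 2-chain with boundary [c]; these are
    collected in [T0]. *)
Lemma null_homologous_push K L (f : V -> V) c :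
  (forall x y z, K [set x; y; z] -> L [set f x; f y; f z]) ->
  null_homologous K c -> exists T0 : seq V, forall T, uniq T ->
    {subset T0 <= T} -> null_homologous L (push1 f T c : V * V -> G).
Proof.
move=> KL [d Kd dc]; have [fd _ _ _] := Kd; have [T0 _ dT0] := finite_vertices2 fd.
exists T0 => T uT T0T; exists (push2 f T d); first exact: push2_chain2 Kd.
move=> p; rewrite push_boundary//; last first.
  by move=> x y z /dT0[xT yT zT]; split; exact: T0T.
by congr (push1 f T _ p); apply/funext.
Qed.

End word_chains.

(** * Inclusions on homology *)

Section H1_inclusion.
Local Open Scope quotient_scope.
Context {V : choiceType} {G : zmodType} {K L : simplicial_complex V}.
Context (KL : subcomplex K L).

Definition is_cycle (M : simplicial_complex V) (c : V * V -> G) :=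
  chain1 M c /\ forall x, boundary1 c x = 0.

Definition homology_surjective := forall c, is_cycle L c ->
  exists2 c', is_cycle K c' & null_homologous L (c - c').

Definition homology_injective := forall c, is_cycle K c ->
  null_homologous L c -> null_homologous K c.

Let pi_eq (M : simplicial_complex V) (z z' : cycle1 G M) :
  \pi_(H1 G M) z = \pi_(H1 G M) z' <-> null_homologous M (val z - val z').
Proof.
split=> [/eqP|zz']; last apply/eqP.
  by rewrite -Quotient.idealrBE => /asboolP[d Md dz]; exists d.
rewrite -Quotient.idealrBE; apply/asboolP.
by case: zz' => d Md dz; exists d.
Qed.

Let cycleP (M : simplicial_complex V) (z : cycle1 G M) : is_cycle M (val z).
Proof. by case: z => c /= /asboolP. Qed.

Let cycle_lift (M : simplicial_complex V) c : is_cycle M c ->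
  exists z : cycle1 G M, val z = c.
Proof.
move=> Mc; have cM : c \in is_cycle1 M by apply/asboolP.
by exists (Cycle1 cM).
Qed.

Lemma H1_inclusion_bijective : bijective (H1_map KL : H1 G K -> H1 G L) <->
  homology_surjective /\ homology_injective.
Proof.
have H1_pi (M : simplicial_complex V) (a : H1 G M) : exists z, a = \pi_(H1 G M) z.
  by exists (repr a); rewrite reprK.
split=> [[g gK Kg]|[surj inj]].
  split=> [c Lc|c Kc Lc].
    have [z zc] := cycle_lift Lc.
    have [z' gz'] := H1_pi K (g (\pi_(H1 G L) z)).
    exists (val z'); first exact: cycleP.
    rewrite -zc; apply/(pi_eq z (cycle1_incl KL z')).
    by rewrite -H1_map_pi -gz' Kg.
  have [z zc] := cycle_lift Kc.
  have /pi_eq : \pi_(H1 G K) z = \pi_(H1 G K) 0; last by rewrite subr0 zc.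
  apply: (can_inj gK); rewrite !H1_map_pi; apply/pi_eq.
  by rewrite /= subr0 zc.
apply: surjective_bijective => [a a'|a].
  have [z ->] := H1_pi _ a; have [z' ->] := H1_pi _ a'.
  rewrite !H1_map_pi => /pi_eq/= zz'; apply/pi_eq; apply: inj => //.
  by have := cycleP (z - z'); rewrite raddfB.
have [z ->] := H1_pi _ a; have [c Kc zc] := surj _ (cycleP z).
have [z' z'c] := cycle_lift Kc.
exists (\pi_(H1 G K) z'); rewrite H1_map_pi; apply/pi_eq => /=.
by rewrite z'c -opprB; exact: null_homologousN.
Qed.

End H1_inclusion.

Section word_cycles.
Context {V : choiceType} {G : zmodType}.
Implicit Types (K L M : simplicial_complex V) (c : V * V -> G).

Lemma null_homologous_words M (l : seq (G * (V * V))) (W : V -> V -> seq V) :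
  (forall t, t \in l -> edge_equiv M (W t.2.1 t.2.2) [:: t.2.1; t.2.2]) ->
  null_homologous M (\sum_(t <- l) word_chain (W t.2.1 t.2.2) t.1 -
                     \sum_(t <- l) edge_chain t.2.1 t.2.2 t.1).
Proof.
move=> lW; rewrite -sumrB; apply: null_homologous_sum => t tl.
by have := word_chain_equiv t.1 (lW t tl); rewrite /= addr0.
Qed.

Lemma homologous_cycle K L M c c' : is_cycle L c -> chain1 K c' ->
  null_homologous M (c' - c) -> is_cycle K c'.
Proof.
move=> [[fc _ _ _] bc] Kc' cc'; split=> // x.
have [fc' _ _ _] := Kc'; have := null_homologous_boundary1 x cc'.
by rewrite boundary1B// bc subr0.
Qed.

End word_cycles.

(** * Homology of samples *)

Section rips_homology.
Context {R : realType} {X : metricType R} {G : zmodType}.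
Implicit Types (A S : set X) (p q r : R) (c : X * X -> G).

Lemma rips_homology_surjective p q : geodesic X -> 0 < p -> p <= q ->
  homology_surjective (G := G) (K := rips [set: X] p) (L := rips [set: X] q).
Proof.
move=> geoX p0 pq c Lc; have [l lE cE] := chain1_edges Lc.1.
have /choice[u hu] : forall e : X * X, exists u : seq X,
    edge (rips [set: X] q) e.1 e.2 -> path (edge (rips [set: X] p)) e.1 u /\
      edge_equiv (rips [set: X] q) (e.1 :: u) [:: e.1; e.2].
  move=> [x y] /=; have [/edge_ripsP[_ _ xy]|] := boolP (edge (rips [set: X] q) x y).
    have [u [_ xu _ Eu]] := rips_edge_subdivision geoX p0 pq xy.
    by exists u => _; split=> //; exact: rips_path.
  by exists [::].
pose W x y := x :: u (x, y).
pose c' := \sum_(t <- l) word_chain (W t.2.1 t.2.2) t.1.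
have c'c : null_homologous (rips [set: X] q) (c' - c).
  by rewrite cE; apply: null_homologous_words => t /lE/(hu (_, _))[].
exists c'; last by rewrite -opprB; exact: null_homologousN.
apply: homologous_cycle Lc _ c'c; apply: chain1_sum => t /lE/(hu (_, _))[xu _].
exact: walk_chain_chain1.
Qed.

Lemma rips_null_open A q c : null_homologous (rips A q) c ->
  exists2 p, p < q & null_homologous (rips A p) c.
Proof.
move=> [d [fd Kd ad dd] dc].
pose D (t : X * X * X) := diameter [set t.1.1; t.1.2; t.2].
have [n0|D0] := pselect ([set p | d p != 0] !=set0); last first.
  exists (q - 1); first by rewrite ltrBlDr ltrDl.
  exists d => //; split=> // x y z dxyz; exfalso; apply: D0; by exists (x, y, z).
have [|m [[[x y] z] dxyz <-] mD] := finite_has_max (finite_image D fd).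
  by have [t dt] := n0; exists (D t), t.
have [_ _ _ mq] := Kd x y z dxyz.
exists ((D (x, y, z) + q) / 2); first by rewrite /D /=; lra.
exists d => //; split=> // x' y' z' dxyz'.
have [fs s0 sA _] := Kd _ _ _ dxyz'; split=> //.
have := mD _ (ex_intro2 _ _ (x', y', z') dxyz' erefl); rewrite /D /= => ?.
by apply: le_lt_trans (_ : diameter [set x; y; z] < _) => //; lra.
Qed.

Lemma H1_bonding_iso_injective p q : H1_bonding_iso (X := X) G p q ->
  homology_injective (G := G) (K := rips [set: X] p) (L := rips [set: X] q).
Proof. by move=> [pq /H1_inclusion_bijective[]]. Qed.

Lemma H1_sampling (b : X) (r c : R) (S : set X) :
  compact [set: X] -> geodesic X ->
  critical_threshold (@H1_bonding_iso R X G) r c ->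
  dense_within ((r - c) / 2) S -> bijective (mu_H1 G S r).
Proof.
move=> cX geoX crit /(sample_scale b cX)[p [e [f [[cp pr e0 per] [fS fe fK]]]]].
have p0 : 0 < p by exact: lt_trans (critical_threshold_gt0 crit) cp.
have cycle_mono q s a : q <= s -> is_cycle (rips [set: X] q) a ->
    is_cycle (G := G) (rips [set: X] s) a.
  move=> qs [[fa Ka aa da] ba]; split=> //; split=> // x y /Ka.
  exact: rips_sub.
have inj : homology_injective (G := G) (K := rips [set: X] p) (L := rips [set: X] r).
  move=> a; apply: (@threshold_injective R (@H1_bonding_iso R X G) (X * X -> G)
    (fun q => is_cycle (rips [set: X] q)) (fun q => null_homologous (rips [set: X] q))
    r c _ _ _ _ crit p cp pr) => {a}.
  - exact: H1_bonding_iso_injective.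
  - exact: cycle_mono.
  - by move=> q s a qs; apply: null_homologous_sub; exact: rips_sub.
  - exact: rips_null_open.
have simp := sample_triangle per fS fe.
apply/H1_inclusion_bijective; split=> [a Xa|a Sa Xa].
  have [z Xz az] := rips_homology_surjective geoX p0 (ltW pr) Xa.
  have [l lE zE] := chain1_edges Xz.1.
  pose z' := \sum_(t <- l) edge_chain (f t.2.1) (f t.2.2) t.1.
  have zz' : null_homologous (rips [set: X] r) (z - z').
    (* Inserting the terms [x, f x] costs nothing, as their sum telescopes; each
       summand is then bounded by a filling of the quadrilateral x, f x, f y, y. *)
    have -> : z - z' = \sum_(t <- l) (edge_chain t.2.1 t.2.2 t.1 -
        edge_chain t.2.1 (f t.2.1) t.1 - edge_chain (f t.2.1) (f t.2.2) t.1 -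
        edge_chain (f t.2.2) t.2.2 t.1).
      rewrite zE -sumrB -[LHS]subr0.
      rewrite -[X in _ - X](cycle_telescope (l := l)
        (fun x => edge_chain x (f x) : {additive G -> (X * X -> G)})); last first.
        by rewrite -zE; exact: Xz.2.
      rewrite -sumrB; apply: eq_bigr => t _.
      have swap (A : zmodType) (x y u v : A) : x - y - (u - v) = x - u - y + v.
        by rewrite opprB [LHS](AC (2*2) (1*4*2*3)).
      by rewrite (edge_chain_sym t.2.2 (f t.2.2)) opprK; exact: swap.
    apply: null_homologous_sum => t /lE/edge_ripsP[_ _ xy].
    have xyr : edge_equiv (rips [set: X] r) [:: t.2.1; t.2.2]
        [:: t.2.1; f t.2.1; f t.2.2; t.2.2].
      have := fe t.2.1; have := fe t.2.2; have := sample_mdist fe t.2.1 t.2.2.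
      move: t.2.1 t.2.2 xy => x y xy fxy fy fx.
      have xfy : mdist x (f y) < r by have := metric_triangle x y (f y) => ?; lra.
      apply: edge_sym; apply: edge_trans (edge_triangle [::] [:: y] _) _.
        by apply: rips3 => //; lra.
      have fyy : mdist (f y) y < r by rewrite metric_sym; lra.
      by apply: (edge_triangle [::] [::]); apply: rips3 => //; lra.
    have := word_chain_equiv t.1 xyr; rewrite /= !addr0 !opprD.
    by rewrite !addrA.
  have z'E : chain1 (rips S r) z'.
    apply: chain1_sum => t /lE/edge_ripsP[_ _ xy]; apply: edge_chain_chain1.
    apply/edge_ripsP; split=> //.
    by have := sample_mdist fe t.2.1 t.2.2 => ?; lra.
  exists z'.
    apply: homologous_cycle Xz z'E _ => //.
    by rewrite -opprB; exact: null_homologousN zz'.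
  by have := null_homologousD az zz'; rewrite subrKA.
have [l lE aE] := chain1_edges Sa.1.
have /choice[u hu] : forall x : X * X, exists u : seq X,
    edge (rips S r) x.1 x.2 -> [/\ path (edge (rips [set: X] p)) x.1 u,
      edge_equiv (rips [set: X] r) (x.1 :: u) [:: x.1; x.2] &
      edge_equiv (rips S r) (map f (x.1 :: u)) [:: x.1; x.2]].
  move=> [x y] /=; have [/edge_ripsP[Sx Sy xy]|] := boolP (edge (rips S r) x y).
    have [u [_ xu _ Eu fEu]] := sample_edge geoX p0 e0 per fS fe fK Sx Sy xy.
    by exists u.
  by exists [::].
pose W x y := x :: u (x, y).
pose z := \sum_(t <- l) word_chain (W t.2.1 t.2.2) t.1.
have za : null_homologous (rips [set: X] r) (z - a).
  by rewrite aE; apply: null_homologous_words => t /lE/(hu (_, _))[].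
have Xz : is_cycle (rips [set: X] p) z.
  apply: homologous_cycle Sa _ za; apply: chain1_sum => t /lE/(hu (_, _))[xu _ _].
  exact: walk_chain_chain1.
have /(null_homologous_push simp)[T0 hT0] : null_homologous (rips [set: X] p) z.
  by apply: inj => //; have := null_homologousD za Xa; rewrite subrK.
pose T := undup (T0 ++ flatten [seq W t.2.1 t.2.2 | t <- l]).
have uT : uniq T := undup_uniq _.
have fz : push1 f T z = \sum_(t <- l) word_chain (map f (W t.2.1 t.2.2)) t.1.
  rewrite raddf_sum /=; apply: eq_big_seq => t tl.
  have WT : {subset W t.2.1 t.2.2 <= T}.
    move=> v vW; rewrite mem_undup mem_cat; apply/orP; right.
    by apply/flattenP; exists (W t.2.1 t.2.2) => //; apply/mapP; exists t.
  rewrite push1_walk//; first by apply: WT; rewrite mem_head.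
  by move=> v vu; apply: WT; rewrite inE vu orbT.
have fza : null_homologous (rips S r) (push1 f T z - a).
  rewrite fz aE; apply: (null_homologous_words (W := fun x y => map f (W x y))).
  by move=> t /lE/(hu (_, _))[].
move: fza => /(null_homologousB (hT0 T uT _)).
rewrite opprB addrC subrK; apply.
by move=> v vT0; rewrite mem_undup mem_cat vT0.
Qed.

End rips_homology.

Theorem theorem4p2 (R : realType) (X : metricType R) (b : X) (G : zmodType)
    (r : R) (r0 : 0 < r) :
  compact [set: X] -> geodesic X ->
  (forall (c : R) (S : set X) (Sb : S b),
     critical_threshold (pi1_bonding_iso b) r c ->
     finite_set S -> dense_within ((r - c) / 2) S ->
     bijective (mu_pi1 Sb r0)) /\
  (forall (c : R) (S : set X) (Sb : S b),
     critical_threshold (@H1_bonding_iso R X G) r c ->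
     finite_set S -> dense_within ((r - c) / 2) S ->
     bijective (mu_H1 G S r)).
Proof.
move=> cX geoX; split=> c S Sb crit _ dS.
- exact: pi1_sampling crit dS.
- exact: (H1_sampling b cX geoX crit dS).
Qed.
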